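(* Let $m\ge1$ and let $\mu\in\mathfrak h^*$ be a weight of $\mathfrak f_m$ such that $\mu_a-\mu_b\notin\mathbb Z$ and $\mu_a+\mu_b\notin\mathbb Z$ whenever $1\le a<b\le m$; in the case $\mathfrak f_m=\mathfrak{sp}_{2m}$ suppose also that $2\mu_a\notin\mathbb Z$ whenever $1\le a\le m$. Then for any element $\sigma\in\mathfrak H_m$ the operator $\check\xi_\sigma$ on $\overline{\mathrm J}\backslash\overline{\mathrm B}_m$ maps $$\overline{\mathrm J}\,\backslash\,(\overline{\mathrm I}_{\mu,\delta_+}+\overline{\mathrm J})\;\to\;\overline{\mathrm J}\,\backslash\,(\overline{\mathrm I}_{\sigma\circ\mu,\,\sigma(\delta_+)}+\overline{\mathrm J}).$$
   Context: Conventions. $n\ge1$ is an integer; $G_n$ is $O_n$ or $Sp_n$ ($n$ even for $Sp_n$). In double signs the upper sign is for $G_n=O_n$, the lower for $G_n=Sp_n$. For $1\le i\le n$: $\tilde\imath=i-1$ if $i$ is even; $\tilde\imath=i+1$ if $i$ is odd, $i<n$; $\tilde\imath=n$ if $i=n$ is odd. $\theta_i=1$ for $O_n$, $\theta_i=(-1)^{i-1}$ for $Sp_n$. $\mathfrak f_m=\mathfrak{sp}_{2m}$ if $G_n=O_n$, $\mathfrak{so}_{2m}$ if $G_n=Sp_n$, realized in $\mathfrak{gl}_{2m}$ (indices $-m,\dots,-1,1,\dots,m$) as the span of $F_{ab}=E_{ab}-\varepsilon_{ab}E_{-b,-a}$, with $\varepsilon_{ab}=\operatorname{sign}a\cdot\operatorname{sign}b$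 for $\mathfrak{sp}_{2m}$, $\varepsilon_{ab}=1$ for $\mathfrak{so}_{2m}$. $\mathfrak h$ is the Cartan subalgebra with basis $F_{-m,-m},\dots,F_{-1,-1}$; $\mathfrak n$ (resp. $\mathfrak n'$) is spanned by $F_{cd}$ with $c>d$ (resp. $c<d$). $\mathcal{PD}(\mathbb C^m\otimes\mathbb C^n)$ is the ring of polynomial differential operators in $x_{ai}$ ($1\le a\le m,1\le i\le n$), $\partial_{ai}=\partial/\partial x_{ai}$. $\zeta_n:\mathrm U(\mathfrak f_m)\to\mathcal{PD}(\mathbb C^m\otimes\mathbb C^n)$ is, for $a,b=1,\dots,m$: $F_{ab}\mapsto\delta_{ab}\frac n2+\sum_kx_{ak}\partial_{bk}$, $F_{a,-b}\mapsto-\sum_k\theta_kx_{a\tilde k}x_{bk}$, $F_{-a,b}\mapsto\sum_k\theta_k\partial_{ak}\partial_{b\tilde k}$. $\mathrm B_m$ is the algebra generated by the subalgebras $\mathrm U(\mathfrak f_m)$ and $\mathcal{PD}(\mathbb C^m\otimes\mathbb C^n)$ with cross relations $[X,Y]=[\zeta_n(X),Y]$ for $X\in\mathfrak f_m$, $Y\in\mathcal{PD}(\mathbb C^m\otimes\mathbb C^n)$; equivalently $\mathrm B_m\cong\mathrm U(\mathfrak f_m)\otimes\mathcal{PD}(\mathbb C^m\otimes\mathbb C^n)$ via $X\mapsto X\otimes1+1\otimes\zeta_n(X)$, $Y\mapsto1\otimes Y$. Weights and roots. For $c>0$ put $\bar c=m+1-c$; for $c<0$ put $\bar c=-m-1-c$.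 $\varepsilon_1,\dots,\varepsilon_m\in\mathfrak h^*$ is the basis dual to $F_{-\bar a,-\bar a}$ ($a=1,\dots,m$); $\varepsilon_{-a}=-\varepsilon_a$. A weight $\mu$ is identified with its labels $\mu_a=\mu(F_{-\bar a,-\bar a})$. Positive roots $\Delta^+$: $\varepsilon_a\pm\varepsilon_b$ ($a<b$), and also $2\varepsilon_a$ for $\mathfrak{sp}_{2m}$. Simple roots: $\eta_a=\varepsilon_a-\varepsilon_{a+1}$ ($a<m$), $\eta_m=2\varepsilon_m$ for $\mathfrak{sp}_{2m}$, $\eta_m=\varepsilon_{m-1}+\varepsilon_m$ for $\mathfrak{so}_{2m}$, $m>1$; none for $\mathfrak{so}_2$. $\rho$ is the half-sum of positive roots. For $a<m$: $E_a=F_{-\bar a,-\overline{a+1}}$, $F_a=F_{-\overline{a+1},-\bar a}$, $H_a=F_{-\bar a,-\bar a}-F_{-\overline{a+1},-\overline{a+1}}$. For $\mathfrak{sp}_{2m}$: $E_m=F_{-1,1}/2$, $F_m=F_{1,-1}/2$, $H_m=F_{-1,-1}$. For $\mathfrak{so}_{2m}$, $m>1$: $E_m=F_{-2,1}$, $F_m=F_{1,-2}$, $H_m=F_{-2,-2}+F_{-1,-1}$. Groups. $\mathfrak H_m$ is the group of permutations $\sigma$ of $\{\pm1,\dots,\pm m\}$ with $\sigma(-c)=-\sigma(c)$, generated by $\sigma_a$ ($a<m$), exchanging $a,a+1$ (and $-a,-a-1$), and $\sigma_m$, exchanging $m,-m$. It acts on $\mathfrak h^*$ by $\sigma(\varepsilon_c)=\varepsilon_{\sigma(c)}$,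 and by the shifted action $\sigma\circ\mu=\sigma(\mu+\rho)-\rho$. Put $\sigma'_m=\sigma_m\sigma_{m-1}\sigma_m$. $\mathfrak B_m$ is the braid group with generators $\tilde\sigma_1,\dots,\tilde\sigma_m$ subject to the braid relations of $\sigma_1,\dots,\sigma_m$ (type $C_m$); $\tilde\sigma=\tilde\sigma_{a_1}\cdots\tilde\sigma_{a_K}$ for a reduced decomposition $\sigma=\sigma_{a_1}\cdots\sigma_{a_K}$. With $\bar\sigma(c)=\overline{\sigma(\bar c)}$, $\mathfrak B_m$ acts on $\mathrm B_m$ by automorphisms: for $a<m$, $\tilde\sigma_a:F_{cd}\mapsto F_{\bar\sigma_a(c)\bar\sigma_a(d)}$, $x_{bi}\mapsto x_{\bar\sigma_a(b)i}$, $\partial_{bi}\mapsto\partial_{\bar\sigma_a(b)i}$; $\tilde\sigma_m:F_{cd}\mapsto(\mp1)^{\delta_{c1}+\delta_{d1}}F_{\bar\sigma_m(c)\bar\sigma_m(d)}$, $x_{1i}\mapsto-\theta_i\partial_{1\tilde\imath}$, $\partial_{1i}\mapsto\theta_ix_{1\tilde\imath}$, and $x_{bi},\partial_{bi}$ with $b>1$ are fixed. Localization. $\overline{\mathrm U(\mathfrak h)}$ is the ring of fractions of $\mathrm U(\mathfrak h)$ with denominators $F_{aa}-F_{bb}+z$, $F_{aa}+F_{bb}+z$ ($1\le a<b\le m$, $z\in\mathbb Z$) and, for $\mathfrak{sp}_{2m}$, also $F_{aa}+z$ ($1\le a\le m$, $z\in\mathbb Z$); its elements are rational functions on $\mathfrak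 h^*$. $\overline{\mathrm B}_m$ is the (Ore) ring of fractions of $\mathrm B_m$ with the same denominators; the $\mathfrak B_m$-action extends to it. $\overline{\mathrm J}$ is the right ideal of $\overline{\mathrm B}_m$ generated by $\mathfrak n$; $\overline{\mathrm J}\backslash\overline{\mathrm B}_m$ is the quotient vector space, and for a subspace $\mathrm L\supset\overline{\mathrm J}$, $\overline{\mathrm J}\backslash\mathrm L$ is its image. Zhelobenko operators. For a simple root $\eta_a$, $\xi_a:\mathrm B_m\to\overline{\mathrm B}_m$ is $\xi_a(Y)=Y+\sum_{s\ge1}(s!\,H_a^{(s)})^{-1}E_a^s\,\widehat F_a^s(Y)$, with $H_a^{(s)}=H_a(H_a-1)\cdots(H_a-s+1)$, $\widehat F_a(Y)=[F_a,Y]$. The linear map $\bar\xi_a:\overline{\mathrm B}_m\to\overline{\mathrm J}\backslash\overline{\mathrm B}_m$ is $\bar\xi_a(XY)=Z\,\xi_a(Y)+\overline{\mathrm J}$ for $X\in\overline{\mathrm U(\mathfrak h)}$, $Y\in\mathrm B_m$, where $Z(\mu)=X(\mu+\eta_a)$. The operator $\check\xi_a$ on $\overline{\mathrm J}\backslash\overline{\mathrm B}_m$ is induced by $\bar\xi_a\tilde\sigma$, where $\sigma=\sigma_a$, except $\sigma=\sigma'_m$ if $\mathfrak f_m=\mathfrak{so}_{2m}$ and $a=m$. For $\mathfrak{sp}_{2m}$, $\check\xi_\sigma=\check\xi_{a_1}\cdots\check\xi_{a_K}$ for any reduced decomposition $\sigma=\sigma_{a_1}\cdots\sigma_{a_K}$.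 For $\mathfrak{so}_{2m}$, $\tilde\sigma_m$ preserves $\overline{\mathrm J}$, hence acts on $\overline{\mathrm J}\backslash\overline{\mathrm B}_m$, and $\check\xi_\sigma$ is obtained by substituting $\check\xi_1,\dots,\check\xi_{m-1},\tilde\sigma_m$ for $\sigma_1,\dots,\sigma_m$ in any decomposition of $\sigma$ with the minimal possible number of occurrences of $\sigma_1,\dots,\sigma_{m-1}$. These are independent of choices. Ideals. $\delta=(\delta_1,\dots,\delta_m)$ denotes a sequence with $\delta_a\in\{1,-1\}$; $\delta_+=(1,\dots,1)$. $\mathfrak H_m$ acts on sequences: $\sigma_a$ ($a<m$) exchanges $\delta_a,\delta_{a+1}$, $\sigma_m$ changes the sign of $\delta_m$. $\mathrm I_\delta$ is the left ideal of $\mathrm B_m$ generated by $x_{\bar ai}$ with $\delta_a=-1$ and $\partial_{\bar ai}$ with $\delta_a=1$ ($1\le a\le m$, $1\le i\le n$). $\mathrm J'$ is the left ideal of $\mathrm B_m$ generated by $X-\zeta_n(X)$, $X\in\mathfrak n'$. $\mathrm I_{\mu,\delta}$ is the left ideal of $\mathrm B_m$ generated by $\mathrm I_\delta+\mathrm J'$ and by $F_{-\bar a,-\bar a}-\zeta_n(F_{-\bar a,-\bar a})-\mu_a$, $a=1,\dots,m$; $\overline{\mathrm I}_{\mu,\delta}=\overline{\mathrm U(\mathfrak h)}\,\mathrm I_{\mu,\delta}$, a left ideal of $\overline{\mathrm B}_m$. *)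

(* Defs.v *)
From HB Require Import structures.
From mathcomp Require Import all_boot all_order all_algebra perm.
From mathcomp Require Import boolp classical_sets fsbigop.

Set Implicit Arguments.
Unset Strict Implicit.
Unset Printing Implicit Defensive.

Import Order.TTheory GRing.Theory Num.Theory.

Local Open Scope classical_set_scope.
Local Open Scope quotient_scope.
Local Open Scope ring_scope.

(* MathComp's algType excludes the zero ring; for algebras given by generators
   and relations we use a structure that does not presuppose 1 != 0. *)
Record kAlg (K : comNzRingType) := KAlg {
  kAlg_ring :> pzRingType;
  kst : {rmorphism K -> kAlg_ring};
  kstC : forall k x, kst k * x = x * kst k
}.

Definition commr (A : pzRingType) (x y : A) : A := x * y - y * x.

Definition alg_morph (K : comNzRingType) (A B : kAlg K) (f : A -> B) : Prop :=
  [/\ forall k, f (kst A k) = kst B k,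
      {morph f : x y / x + y} & {morph f : x y / x * y}].

Section AlgMorph.
Variables (K : comNzRingType) (A B : kAlg K) (f : A -> B) (hf : alg_morph f).

Lemma alg_morphC k : f (kst A k) = kst B k. Proof. by case: hf. Qed.
Lemma alg_morphD : {morph f : x y / x + y}. Proof. by case: hf. Qed.
Lemma alg_morphM : {morph f : x y / x * y}. Proof. by case: hf. Qed.
Lemma alg_morph1 : f 1 = 1.
Proof. by rewrite -(rmorph1 (kst A)) alg_morphC rmorph1. Qed.
Lemma alg_morph0 : f 0 = 0.
Proof. by rewrite -(rmorph0 (kst A)) alg_morphC rmorph0. Qed.
Lemma alg_morphN : {morph f : x / - x}.
Proof.
by move=> x; apply/eqP; rewrite -subr_eq0 opprK -alg_morphD addNr alg_morph0.
Qed.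
Lemma alg_morph_comm : {morph f : x y / commr x y}.
Proof.
by move=> x y; rewrite /commr alg_morphD alg_morphN !alg_morphM.
Qed.
Lemma alg_morph_sum (I : finType) (F : I -> A) :
  f (\sum_i F i) = \sum_i f (F i).
Proof. exact: (big_morph f alg_morphD alg_morph0). Qed.

End AlgMorph.

Section Presented.
Variables (K : comNzRingType) (I : Type).

Inductive aterm : Type :=
  | TCst of K | TGen of I | TAdd of aterm & aterm | TMul of aterm & aterm.

HB.instance Definition _ := gen_eqMixin aterm.
HB.instance Definition _ := gen_choiceMixin aterm.

Fixpoint aeval (A : kAlg K) (g : I -> A) (t : aterm) : A :=
  match t with
  | TCst k => kst A k
  | TGen i => g i
  | TAdd t u => aeval g t + aeval g u
  | TMul t u => aeval g t * aeval g u
  end.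

(* [presented rels] is the initial algebra with a family of elements indexed by
   I that satisfies the relations [rels]: two terms in the generators are
   identified when they agree in every algebra satisfying these relations. *)
Variable rels : forall A : kAlg K, (I -> A) -> Prop.

Definition aeq (t u : aterm) : bool :=
  `[< forall (A : kAlg K) (g : I -> A), rels g -> aeval g t = aeval g u >].

Lemma aeqP t u : reflect
  (forall (A : kAlg K) (g : I -> A), rels g -> aeval g t = aeval g u)
  (aeq t u).
Proof. exact: asboolP. Qed.

Lemma aeq_equiv : equiv_class_of aeq.
Proof.
split=> [t|t u|t u v].
- exact/aeqP.
- by apply/aeqP/aeqP => h A g hg; rewrite h.
- by move=> /aeqP h1 /aeqP h2; apply/aeqP => A g hg; rewrite h1 ?h2.
Qed.

Canonical aeq_equiv_canonical := EquivRelPack aeq_equiv.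
Canonical aeq_encModRel := defaultEncModRel aeq.

Definition pcarrier : Type := {eq_quot aeq}.
HB.instance Definition _ := Choice.on pcarrier.
HB.instance Definition _ : EqQuotient aterm aeq pcarrier :=
  EqQuotient.on pcarrier.

Let P (t : aterm) : pcarrier := \pi t.

Definition peval (A : kAlg K) (g : I -> A) (p : pcarrier) : A :=
  aeval g (repr p).

Lemma pevalE (A : kAlg K) (g : I -> A) t :
  rels g -> peval g (\pi_pcarrier t) = aeval g t.
Proof.
move=> hg; rewrite /peval.
have : aeq (repr (\pi_pcarrier t)) t by rewrite -eqmodE reprK.
by move/aeqP; apply.
Qed.

Lemma presented_eqP (p q : pcarrier) :
  (forall (A : kAlg K) (g : I -> A), rels g -> peval g p = peval g q) ->
  p = q.
Proof.
rewrite -[p]reprK -[q]reprK => h; apply/eqmodP/aeqP => A g hg.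
by have := h A g hg; rewrite !pevalE.
Qed.

Definition pcst (k : K) : pcarrier := P (TCst k).
Definition popp (p : pcarrier) : pcarrier := P (TMul (TCst (-1)) (repr p)).
Definition padd (p q : pcarrier) : pcarrier := P (TAdd (repr p) (repr q)).
Definition pmul (p q : pcarrier) : pcarrier := P (TMul (repr p) (repr q)).

Section Peval.
Variables (A : kAlg K) (g : I -> A) (hg : rels g).
Lemma pevalC k : peval g (pcst k) = kst A k.
Proof. by rewrite pevalE. Qed.
Lemma pevalN p : peval g (popp p) = - peval g p.
Proof. by rewrite pevalE //= rmorphN1 mulN1r. Qed.
Lemma pevalD p q : peval g (padd p q) = peval g p + peval g q.
Proof. by rewrite pevalE. Qed.
Lemma pevalM p q : peval g (pmul p q) = peval g p * peval g q.
Proof. by rewrite pevalE. Qed.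
End Peval.

Let pE := (pevalC, pevalN, pevalD, pevalM, rmorph0, rmorph1).

Fact paddA : associative padd.
Proof. by move=> *; apply: presented_eqP => *; rewrite !pE // addrA. Qed.
Fact paddC : commutative padd.
Proof. by move=> *; apply: presented_eqP => *; rewrite !pE // addrC. Qed.
Fact padd0 : left_id (pcst 0) padd.
Proof. by move=> *; apply: presented_eqP => *; rewrite !pE // add0r. Qed.
Fact paddN : left_inverse (pcst 0) popp padd.
Proof. by move=> *; apply: presented_eqP => *; rewrite !pE // addNr. Qed.
HB.instance Definition _ :=
  GRing.isZmodule.Build pcarrier paddA paddC padd0 paddN.

Fact pmulA : associative pmul.
Proof. by move=> *; apply: presented_eqP => *; rewrite !pE // mulrA. Qed.
Fact pmul1 : left_id (pcst 1) pmul.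
Proof. by move=> *; apply: presented_eqP => *; rewrite !pE // mul1r. Qed.
Fact pmulr1 : right_id (pcst 1) pmul.
Proof. by move=> *; apply: presented_eqP => *; rewrite !pE // mulr1. Qed.
Fact pmulDl : left_distributive pmul padd.
Proof. by move=> *; apply: presented_eqP => *; rewrite !pE // mulrDl. Qed.
Fact pmulDr : right_distributive pmul padd.
Proof. by move=> *; apply: presented_eqP => *; rewrite !pE // mulrDr. Qed.
HB.instance Definition _ :=
  GRing.Zmodule_isPzRing.Build pcarrier pmulA pmul1 pmulr1 pmulDl pmulDr.

Fact pcst_zmod : zmod_morphism pcst.
Proof. by move=> x y; apply: presented_eqP => A g hg; rewrite !pE // rmorphB. Qed.
Fact pcst_monoid : monoid_morphism pcst.
Proof.
by split=> // x y; apply: presented_eqP => A g hg; rewrite !pE // rmorphM.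
Qed.
HB.instance Definition _ := GRing.isZmodMorphism.Build K pcarrier pcst pcst_zmod.
HB.instance Definition _ :=
  GRing.isMonoidMorphism.Build K pcarrier pcst pcst_monoid.

Fact pcstC k (x : pcarrier) : pcst k * x = x * pcst k.
Proof. by apply: presented_eqP => A g hg; rewrite !pE // kstC. Qed.

Definition presented : kAlg K := KAlg pcstC.

Definition pgen (i : I) : presented := P (TGen i).

Lemma peval_gen (A : kAlg K) (g : I -> A) i : rels g -> peval g (pgen i) = g i.
Proof. by move=> hg; rewrite pevalE. Qed.

Lemma peval_morph (A : kAlg K) (g : I -> A) :
  rels g -> alg_morph (peval g : presented -> A).
Proof.
by move=> hg; split=> *; [exact: pevalC | exact: pevalD | exact: pevalM].
Qed.

Lemma presented_ind (S : presented -> Prop) :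
  (forall k, S (kst presented k)) -> (forall i, S (pgen i)) ->
  (forall x y, S x -> S y -> S (x + y)) ->
  (forall x y, S x -> S y -> S (x * y)) -> forall x, S x.
Proof.
move=> hC hG hA hM x; rewrite -[x]reprK.
have -> : \pi_pcarrier (repr x) = aeval pgen (repr x).
  elim: (repr x) => [k|i|t IHt u IHu|t IHt u IHu] //=.
  - by rewrite -IHt -IHu; apply: presented_eqP => A g hg; rewrite !pE // !pevalE.
  - by rewrite -IHt -IHu; apply: presented_eqP => A g hg; rewrite !pE // !pevalE.
by elim: (repr x) => /=; auto.
Qed.

End Presented.

Section Localization.
Variables (K : comNzRingType) (A : kAlg K) (D : Type) (den : D -> A).

Definition loc_rels (B : kAlg K) (g : A + D -> B) : Prop :=
  alg_morph (fun a => g (inl a)) /\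
  forall d, g (inr d) * g (inl (den d)) = 1 /\ g (inl (den d)) * g (inr d) = 1.

(* The ring of fractions of A with denominators [den d], as the universal
   algebra under A in which these elements become invertible; when the
   denominators generate an Ore set this is the Ore localization. *)
Definition loc : kAlg K := presented loc_rels.
Definition loc_map (a : A) : loc := pgen loc_rels (inl a).
Definition loc_inv (d : D) : loc := pgen loc_rels (inr d).

Lemma loc_relsP : loc_rels (pgen loc_rels).
Proof.
split=> [|d]; last first.
  by split; apply: presented_eqP => B g hg; have := peval_morph hg => hf;
    rewrite (alg_morphM hf) (alg_morph1 hf) !peval_gen //; case: hg => _ /(_ d)[].
split=> [k|x y|x y]; apply: presented_eqP => B g hg;
    have := peval_morph hg => hf.
- by rewrite (alg_morphC hf) peval_gen //; case: hg => /alg_morphC ->.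
- by rewrite (alg_morphD hf) !peval_gen //; case: hg => /alg_morphD ->.
- by rewrite (alg_morphM hf) !peval_gen //; case: hg => /alg_morphM ->.
Qed.

End Localization.

Section Ideals.
Variable A : zmodType.

Definition fin_sums (S : set A) : set A :=
  [set x | exists k (u : 'I_k -> A), (forall i, S (u i)) /\ x = \sum_i u i].

Definition sum_set (S T : set A) : set A :=
  [set x | exists y z, [/\ S y, T z & x = y + z]].

End Ideals.

Definition left_ideal (A : pzRingType) (S : set A) : set A :=
  fin_sums [set x | exists y s, S s /\ x = y * s].

Definition right_ideal (A : pzRingType) (S : set A) : set A :=
  fin_sums [set x | exists s y, S s /\ x = s * y].

Definition right_ideal_pred (A : pzRingType) (S : set A) : {pred A} :=
  [pred x | `[< right_ideal S x >]].

Fact right_ideal_closed (A : pzRingType) (S : set A) :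
  zmod_closed (right_ideal_pred S).
Proof.
split; first by apply/asboolP; exists 0, (fun _ => 0); rewrite big_ord0; split=> // -[].
move=> x y /asboolP[k [u [hu ->]]] /asboolP[l [v [hv ->]]]; apply/asboolP.
exists (k + l)%N, (fun i => match fintype.split i with
                      | inl i => u i | inr j => - v j end); split=> [i|].
  case: (fintype.split i) => j; first exact: hu.
  by have [s [z [Ss ->]]] := hv j; exists s, (- z); rewrite mulrN.
rewrite big_split_ord /= -sumrN; congr (_ + _); apply: eq_bigr => i _.
  by rewrite (unsplitK (inl i : 'I_k + 'I_l)).
by rewrite (unsplitK (inr i : 'I_k + 'I_l)).
Qed.

HB.instance Definition _ (A : pzRingType) (S : set A) :=
  GRing.isZmodClosed.Build A (right_ideal_pred S) (right_ideal_closed S).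

(* The quotient of A by the right ideal generated by S. *)
Definition rquot (A : pzRingType) (S : set A) : zmodType :=
  Quotient.quot (right_ideal_pred S).

Definition rpi (A : pzRingType) (S : set A) (x : A) : rquot S :=
  \pi_(Quotient.quot (right_ideal_pred S)) x.

(* The two-sided inverse of x, if x has one. *)
Definition rinv (A : pzRingType) (x : A) : A :=
  xget 0 [set y | y * x = 1 /\ x * y = 1].

(* GO: G_n = O_n and f_m = sp_(2m); GSp: G_n = Sp_n and f_m = so_(2m). *)
Inductive gtype := GO | GSp.

(* (false, a) stands for the index a+1 and (true, a) for the index -(a+1). *)
Definition idx (m : nat) := (bool * 'I_m)%type.

Section Combinatorics.
Variables (K : numFieldType) (G : gtype) (m : nat).

Local Notation idx := (idx m).
Implicit Types (a b : 'I_m) (c d : idx).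

Definition pos a : idx := (false, a).
Definition opp c : idx := (~~ c.1, c.2).
Definition ival c : int := (-1) ^+ c.1 * (c.2.+1)%:Z.
Definition bar c : idx := (c.1, rev_ord c.2).
Definition is_last a : bool := a.+1 == m.
(* only used when a is not the last index *)
Definition next a : 'I_m := insubd a a.+1.

Definition ix c : 'I_#|{: idx}| := enum_rank c.
Definition veps c d : K :=
  if G is GO then (-1) ^+ c.1 * (-1) ^+ d.1 else 1.
Definition Fmx c d : 'M[K]_#|{: idx}| :=
  delta_mx (ix c) (ix d) - veps c d *: delta_mx (ix (opp d)) (ix (opp c)).

(* Weights are represented by their labels. *)
Local Notation weight := 'rV[K]_m.
Definition eps c : weight := (-1) ^+ c.1 *: delta_mx 0 c.2.
Definition rho : weight :=
  2^-1 *: (\sum_(a < m) \sum_(b < m | (a < b)%N)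
             ((eps (pos a) - eps (pos b)) + (eps (pos a) + eps (pos b)))
           + if G is GO then \sum_(a < m) 2 *: eps (pos a) else 0).

Definition signed_perm (s : {perm idx}) : bool :=
  [forall c, s (opp c) == opp (s c)].
Definition sigma a : {perm idx} :=
  if is_last a then tperm (pos a) (opp (pos a))
  else (tperm (pos a) (pos (next a)) *
        tperm (opp (pos a)) (opp (pos (next a))))%g.
Definition sigma_bar a c : idx := bar (sigma a (bar c)).

Definition wact (s : {perm idx}) (mu : weight) : weight :=
  \sum_a mu 0 a *: eps (s (pos a)).
Definition shifted_act s mu : weight := wact s (mu + rho) - rho.

Definition delta_plus : 'I_m -> int := fun=> 1.
(* With delta_(-a) = - delta_a, this is delta \o s^-1. *)
Definition dact (s : {perm idx}) (delta : 'I_m -> int) : 'I_m -> int :=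
  fun a => let c := (s^-1)%g (pos a) in (-1) ^+ c.1 * delta c.2.

(* The product of the words reads from left to right as a composition of maps. *)
Definition word_of (w : seq 'I_m) (s : {perm idx}) : Prop :=
  forall c, s c = foldr (fun a => sigma a) c w.
Definition word_cost (w : seq 'I_m) : nat :=
  if G is GO then size w else count (fun a => ~~ is_last a) w.
Definition min_word (w : seq 'I_m) (s : {perm idx}) : Prop :=
  word_of w s /\ forall w', word_of w' s -> (word_cost w <= word_cost w')%N.

(* eta_m, and E_m, F_m, H_m below, are those of sp_(2m): for so_(2m) the
   operators xi_check_sigma are built from xi_check_a with a < m only. *)
Definition eta a : weight :=
  if is_last a then 2 *: eps (pos a) else eps (pos a) - eps (pos (next a)).

Inductive den_shape : Type :=
  | DSub of 'I_m & 'I_m & int | DAdd of 'I_m & 'I_m & int | DOne of 'I_m & int.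

Definition den_valid (D : den_shape) : bool :=
  match D with
  | DSub a b _ | DAdd a b _ => (a < b)%N
  | DOne _ _ => if G is GO then true else false
  end.

Definition denom : Type := {D : den_shape | den_valid D}.

(* F_(a,a) = - F_(-a,-a) takes the value - mu_(bar a) at mu. *)
Definition den_at (D : den_shape) (mu : weight) : K :=
  let f a := - mu 0 (rev_ord a) in
  match D with
  | DSub a b z => f a - f b + z%:~R
  | DAdd a b z => f a + f b + z%:~R
  | DOne a z => f a + z%:~R
  end.

Definition regular (mu : weight) : Prop :=
  forall D : denom, den_at (val D) mu != 0.

(* Formal expressions for the elements of the localized U(h); EVar a stands for
   F_(-bar a, -bar a). *)
Inductive hexpr : Type :=
  | ECst of K | EVar of 'I_m | EAdd of hexpr & hexpr | EMul of hexpr & hexpr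
  | EInv of denom.

Fixpoint hexpr_at (X : hexpr) (mu : weight) : K :=
  match X with
  | ECst k => k
  | EVar a => mu 0 a
  | EAdd X Y => hexpr_at X mu + hexpr_at Y mu
  | EMul X Y => hexpr_at X mu * hexpr_at Y mu
  | EInv D => (den_at (val D) mu)^-1
  end.

End Combinatorics.

Section Algebra.
Variables (K : numFieldType) (G : gtype) (m n : nat).

Local Notation idx := (idx m).
Local Notation weight := 'rV[K]_m.

Definition theta (i : 'I_n) : K := if G is GO then 1 else (-1) ^+ i.
(* With indices starting at 0: odd i goes to i-1, even i to i+1 if i+1 < n, and
   i = n-1 even is fixed. *)
Definition tilde (i : 'I_n) : 'I_n := insubd i (if odd i then i.-1 else i.+1).

Section Relations.
Variables (A : kAlg K) (F : idx -> idx -> A) (x d : 'I_m -> 'I_n -> A).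

(* The enveloping algebra of f_m, the span of the matrices Fmx in gl_(2m). *)
Definition U_rels : Prop :=
  (forall k : idx -> idx -> K,
     \sum_a \sum_b k a b *: Fmx K G a b = 0 ->
     \sum_a \sum_b kst A (k a b) * F a b = 0) /\
  (forall a b c e (k : idx -> idx -> K),
     Fmx K G a b *m Fmx K G c e - Fmx K G c e *m Fmx K G a b
       = \sum_p \sum_q k p q *: Fmx K G p q ->
     commr (F a b) (F c e) = \sum_p \sum_q kst A (k p q) * F p q).

(* The Weyl algebra, i.e. polynomial differential operators. *)
Definition PD_rels : Prop :=
  forall a b i j,
  [/\ commr (x a i) (x b j) = 0, commr (d a i) (d b j) = 0 &
      commr (d a i) (x b j) = ((a == b) && (i == j))%:R].

Definition zeta_pos (a b : 'I_m) : A :=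
  kst A ((a == b)%:R * (n%:R / 2)) + \sum_k x a k * d b k.

Definition zeta (c e : idx) : A :=
  match c, e with
  | (false, a), (false, b) => zeta_pos a b
  | (false, a), (true, b) => - \sum_k kst A (theta k) * x a (tilde k) * x b k
  | (true, a), (false, b) => \sum_k kst A (theta k) * d a k * d b (tilde k)
  | (true, a), (true, b) => - zeta_pos b a (* F_(-a,-b) = - F_(b,a) *)
  end.

Definition cross_rels : Prop :=
  forall c e b i,
    commr (F c e) (x b i) = commr (zeta c e) (x b i) /\
    commr (F c e) (d b i) = commr (zeta c e) (d b i).

End Relations.

Inductive Bgen : Type :=
  | GenF of idx & idx | GenX of 'I_m & 'I_n | GenD of 'I_m & 'I_n.

Definition B_rels (A : kAlg K) (g : Bgen -> A) : Prop :=
  let F c e := g (GenF c e) in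
  let x a i := g (GenX a i) in
  let d a i := g (GenD a i) in
  [/\ U_rels F, PD_rels x d & cross_rels F x d].

Definition Bm : kAlg K := presented B_rels.
Definition BF c e : Bm := pgen B_rels (GenF c e).
Definition Bx a i : Bm := pgen B_rels (GenX a i).
Definition Bd a i : Bm := pgen B_rels (GenD a i).
Definition Bzeta : idx -> idx -> Bm := zeta Bx Bd.

Lemma zeta_morph (A A' : kAlg K) (f : A -> A') (hf : alg_morph f)
    (x d : 'I_m -> 'I_n -> A) c e :
  f (zeta x d c e) = zeta (fun a i => f (x a i)) (fun a i => f (d a i)) c e.
Proof.
have hp a b : f (zeta_pos x d a b) =
              zeta_pos (fun a i => f (x a i)) (fun a i => f (d a i)) a b.
  rewrite /zeta_pos (alg_morphD hf) (alg_morphC hf) (alg_morph_sum hf).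
  by congr (_ + _); apply: eq_bigr => k _; rewrite (alg_morphM hf).
case: c e => [[] a] [[] b] /=; rewrite ?(alg_morphN hf) ?hp //;
  rewrite (alg_morph_sum hf) ?sumrN; try congr (- _);
  by apply: eq_bigr => k _; rewrite !(alg_morphM hf) (alg_morphC hf).
Qed.

Lemma Bm_rels : B_rels (pgen B_rels).
Proof.
split.
- split=> [k hk|a b c e k hk]; apply: presented_eqP => A g hg;
    have hf := peval_morph hg; case: (hg) => -[h1 h2] _ _.
    rewrite (alg_morph_sum hf) (alg_morph0 hf) -[RHS](h1 _ hk).
    apply: eq_bigr => i _; rewrite (alg_morph_sum hf); apply: eq_bigr => j _.
    by rewrite (alg_morphM hf) (alg_morphC hf) peval_gen.
  rewrite (alg_morph_comm hf) !peval_gen // (h2 _ _ _ _ _ hk).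
  rewrite (alg_morph_sum hf); apply: eq_bigr => i _.
  rewrite (alg_morph_sum hf); apply: eq_bigr => j _.
  by rewrite (alg_morphM hf) (alg_morphC hf) peval_gen.
- move=> a b i j; split; apply: presented_eqP => A g hg;
    have hf := peval_morph hg; case: (hg) => _ /(_ a b i j)[h1 h2 h3] _;
    rewrite (alg_morph_comm hf) !peval_gen // ?(alg_morph0 hf) // h3.
  by case: (_ && _); rewrite ?(alg_morph0 hf) ?(alg_morph1 hf).
- move=> c e b i; split; apply: presented_eqP => A g hg;
    have hf := peval_morph hg; case: (hg) => _ _ /(_ c e b i)[h1 h2];
    rewrite !(alg_morph_comm hf) (zeta_morph hf) !peval_gen // ?h1 ?h2;
    congr (commr (zeta _ _ _ _) _);
    by apply/funext => a; apply/funext => j; rewrite peval_gen.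
Qed.

(* F_(-bar a, -bar a) *)
Definition Bh (a : 'I_m) : Bm := let c := opp (bar (pos a)) in BF c c.

Definition den_B (D : denom G m) : Bm :=
  match val D with
  | DSub a b z => BF (pos a) (pos a) - BF (pos b) (pos b) + z%:~R
  | DAdd a b z => BF (pos a) (pos a) + BF (pos b) (pos b) + z%:~R
  | DOne a z => BF (pos a) (pos a) + z%:~R
  end.

Definition Bbar : kAlg K := loc den_B.
Definition iota_B : Bm -> Bbar := loc_map den_B.

Fixpoint hexpr_B (X : hexpr K G m) : Bbar :=
  match X with
  | ECst k => kst Bbar k
  | EVar a => iota_B (Bh a)
  | EAdd X Y => hexpr_B X + hexpr_B Y
  | EMul X Y => hexpr_B X * hexpr_B Y
  | EInv D => loc_inv den_B D
  end.

Definition n_gens : set Bbar :=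
  [set u | exists c e, (ival e < ival c) /\ u = iota_B (BF c e)].
Definition Jbar : set Bbar := right_ideal n_gens.
Definition JB : zmodType := rquot n_gens.
Definition piJ : Bbar -> JB := rpi n_gens.

Definition E_ (a : 'I_m) : Bm :=
  if is_last a then kst Bm 2^-1 * BF (opp (bar (pos a))) (bar (pos a))
  else BF (opp (bar (pos a))) (opp (bar (pos (next a)))).
Definition F_ (a : 'I_m) : Bm :=
  if is_last a then kst Bm 2^-1 * BF (bar (pos a)) (opp (bar (pos a)))
  else BF (opp (bar (pos (next a)))) (opp (bar (pos a))).
Definition H_ (a : 'I_m) : Bm :=
  if is_last a then Bh a else Bh a - Bh (next a).

Definition H_falling (a : 'I_m) (s : nat) : Bm :=
  \prod_(j < s) (H_ a - (j : nat)%:R).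

Definition xi (a : 'I_m) (Y : Bm) : Bbar :=
  iota_B Y + \sum_(s \in [set s | (1 <= s)%N])
    rinv (iota_B ((s`!)%:R * H_falling a s)) *
    iota_B (E_ a ^+ s) * iota_B (iter s (commr (F_ a)) Y).

(* Taking X constant shows that such a map is linear over K. *)
Definition is_xi_bar (a : 'I_m) (f : Bbar -> JB) : Prop :=
  {morph f : u v / u + v} /\
  forall (X Z : hexpr K G m) (Y : Bm),
    (forall mu : weight, regular G mu ->
       hexpr_at Z mu = hexpr_at X (mu + eta K a)) ->
    f (hexpr_B X * iota_B Y) = piJ (hexpr_B Z * xi a Y).

Definition is_braid_aut (a : 'I_m) (s : Bbar -> Bbar) : Prop :=
  let F c e := iota_B (BF c e) in
  let x b i := iota_B (Bx b i) in
  let d b i := iota_B (Bd b i) in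
  alg_morph s /\
  if is_last a then
    [/\ forall c e : idx,
          let sg := if G is GO then -1 else 1 in
          let is1 (c : idx) := ~~ c.1 && (c.2 == 0%N :> nat) in
          s (F c e) = kst Bbar (sg ^+ (is1 c + is1 e)) *
                      F (sigma_bar a c) (sigma_bar a e),
        forall (b : 'I_m) i, b = 0%N :> nat ->
          s (x b i) = - kst Bbar (theta i) * d b (tilde i) /\
          s (d b i) = kst Bbar (theta i) * x b (tilde i) &
        forall (b : 'I_m) i, b <> 0%N :> nat ->
          s (x b i) = x b i /\ s (d b i) = d b i]
  else
    [/\ forall c e, s (F c e) = F (sigma_bar a c) (sigma_bar a e),
        forall b i, s (x b i) = x (sigma_bar a (pos b)).2 i &
        forall b i, s (d b i) = d (sigma_bar a (pos b)).2 i].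

(* The factor of xi_check_sigma that corresponds to sigma_a: the operator
   xi_check_a, except for so_(2m) and a = m, where it is the action of the braid
   group generator. *)
Definition is_factor (a : 'I_m) (T : JB -> JB) : Prop :=
  exists2 s, is_braid_aut a s &
  match G, is_last a with
  | GSp, true => forall u, T (piJ u) = piJ (s u)
  | _, _ => exists2 f, is_xi_bar a f & forall u, T (piJ u) = f (s u)
  end.

Definition is_xi_check (sg : {perm idx}) (T : JB -> JB) : Prop :=
  exists w (ops : 'I_m -> JB -> JB),
    [/\ min_word G w sg, forall a, a \in w -> is_factor a (ops a) &
        T =1 fun q => foldr (fun a => ops a) q w].

Definition Idelta (delta : 'I_m -> int) : set Bm :=
  left_ideal [set Y | exists a i, let b := (bar (pos a)).2 in
    (delta a = -1 /\ Y = Bx b i) \/ (delta a = 1 /\ Y = Bd b i)].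

Definition Jprime : set Bm :=
  left_ideal [set Y | exists c e, (ival c < ival e) /\ Y = BF c e - Bzeta c e].

Definition Imu (mu : weight) (delta : 'I_m -> int) : set Bm :=
  left_ideal (sum_set (Idelta delta) Jprime `|`
    [set Y | exists a, let c := opp (bar (pos a)) in
       Y = BF c c - Bzeta c c - kst Bm (mu 0 a)]).

Definition Ibar (mu : weight) (delta : 'I_m -> int) : set Bbar :=
  fin_sums [set u | exists (X : hexpr K G m) Y,
                      Imu mu delta Y /\ u = hexpr_B X * iota_B Y].

Definition JI (mu : weight) (delta : 'I_m -> int) : set JB :=
  piJ @` sum_set (Ibar mu delta) Jbar.

End Algebra.

(* Main.v *)
Require Import Defs.
From mathcomp Require Import all_boot all_order all_algebra fingroup perm.
From mathcomp Require Import boolp classical_sets fsbigop reals complex.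
From mathcomp Require Import zify ssrAC.
Import Defs.

(** The operator attached to sigma is a composition of operators attached to the
    letters of a minimal word, so it suffices to follow the ideals I_(mu,delta)
    through one letter a (factor_step).

    Write E, F, H for E_a, F_a, H_a. The braid automorphism maps I_(mu,delta) to
    the left ideal with the following generators, where nu = sigma_a mu and the
    sequence delta is replaced by its reflection (braid_Imu, reflected_gens):
    the x and d selected by the new sequence; X - zeta(X) for X in the nilradical
    of the minimal parabolic subalgebra of a; F - zeta(F), the image of
    E - zeta(E); and h - zeta(h) - nu(h) for h in the Cartan subalgebra. The point
    is to see what xi_a does to y g for an arbitrary y and one of these
    generators g (xi_reflected).

    Suppose that the sequence delta before the reflection does not have
    delta_a = -1, delta_(a+1) = 1, and, for a = m, that delta_m = 1. Then
    - the x, the d and the nilradical generate a left ideal which is stable under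
      the bracket with F (stable_gens_ad) and is contained in the target ideal, so
      for these g every term of the series xi_a (y g) lies in the target ideal;
    - zeta(F) lies in the left ideal generated by the x and d (root_zeta_ideal),
      so that F - zeta(F) may be replaced with F.

    The two remaining cases rest on the identity of U(sl_2)
      E^s F = F E^s + s (H - s + 1) E^(s-1)
    (exp_sl2). With c_s = 1 / (s! H^(s)) it says that c_s E^s F and
    c_(s-1) E^(s-1) agree modulo J. Since y F = F y - [F, y], the series
    xi_a (y F) telescopes to 0 modulo J (sum_ad_mulrF). For a Cartan generator g
    the bracket [F, g] is eta_a(h) (F - zeta(F)), and the series xi_a (y g)
    telescopes to 0 modulo J and the target ideal, in which g + eta_a(h) vanishes
    (sum_ad_weight). Thus the weight nu is replaced with nu - eta_a, and this is
    the shifted action of sigma_a on mu (shifted_act_sigma).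

    The condition on delta comes from minimality of the word: if it failed at some
    letter, then eta_a would become negative under the inverse of the product of
    the letters applied before, and two letters could be deleted from the word
    (minimal_word_positive). For so_(2m) and a = m the factor is the braid
    automorphism itself, which preserves n', while sigma_m fixes rho.

    Both pairs (O_n, sp_(2m)) and (Sp_n, so_(2m)), and all kinds of simple roots,
    are treated at once, by means of basis elements Q of the space of the x and d
    in which the formulas for zeta and for all actions take a single form (zetaE,
    bracket_F_Q), and of signed indices (sigma_signed_swap). *)

Set Implicit Arguments.
Unset Strict Implicit.
Unset Printing Implicit Defensive.

Import GRing.Theory Num.Theory.

Local Open Scope ring_scope.

(** * Signed permutations and minimal words *)

Section SignedPermutations.
Variable m : nat.
Implicit Types (a b : 'I_m) (c d e x : idx m) (v w : seq 'I_m).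

Lemma oppK : involutive (@opp m).
Proof. by case=> [[] a]. Qed.

Lemma opp_inj : injective (@opp m).
Proof. exact: inv_inj oppK. Qed.

Lemma opp_neq c : (opp c == c) = false.
Proof. by case: c => [[] a]. Qed.

Lemma barK : involutive (@bar m).
Proof. by case=> s a; rewrite /bar rev_ordK. Qed.

Lemma bar_opp c : bar (opp c) = opp (bar c).
Proof. by []. Qed.

(** The bijection c |-> - bar c from the indices of weights to those of the
    matrix units: F_(obar c, obar c) has weight label c, and after this
    relabelling the braid automorphism of sigma_a acts by sigma_a itself. *)
Definition obar c := opp (bar c).

Lemma obarK : involutive obar.
Proof. by move=> c; rewrite /obar bar_opp barK oppK. Qed.

Lemma obar_inj : injective obar.
Proof. exact: inv_inj obarK. Qed.

Lemma obar_opp c : obar (opp c) = opp (obar c).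
Proof. by []. Qed.

(** The position of c in the order 1 < ... < m < -m < ... < -1. With
    eps_(-c) = - eps_c the positive roots of type C are, up to a factor, the
    eps_c - eps_d with c before d. *)
Definition rank c : nat := if c.1 then (m.*2 - c.2.+1)%N else c.2.

Lemma rank_inj : injective rank.
Proof.
case=> [[] [a ha]] [[] [b hb]]; rewrite /rank /= => h;
  by [congr (_, _); apply: val_inj; rewrite /=; lia | lia].
Qed.

Lemma rank_lt c : (rank c < m.*2)%N.
Proof. by case: c => [[] [a ha]]; rewrite /rank /=; lia. Qed.

Lemma rank_opp c : rank (opp c) = (m.*2 - (rank c).+1)%N.
Proof. by case: c => [[] [a ha]]; rewrite /rank /=; lia. Qed.

Lemma ival_lt_obar c e :
  (ival (obar c) < ival (obar e)) = (rank c < rank e)%N.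
Proof.
by case: c e => [[] [a ha]] [[] [b hb]]; rewrite /rank /ival /=; lia.
Qed.

Lemma nextE a : ~~ is_last a -> next a = a.+1 :> nat.
Proof.
rewrite /is_last /next => h; rewrite val_insubd.
by have := ltn_ord a; case: ifP => //; lia.
Qed.

(** The successor of a in that order, so that eta_a = eps_a - eps_(nxt a) also
    for a = m in type C, where it is 2 eps_m. *)
Definition nxt a : idx m := if is_last a then opp (pos a) else pos (next a).

Lemma rank_pos a : rank (pos a) = a.
Proof. by []. Qed.

Lemma rank_nxt a : rank (nxt a) = a.+1.
Proof.
rewrite /nxt; case: ifPn => [|/nextE //].
by rewrite rank_opp rank_pos /is_last => /eqP h; lia.
Qed.

Lemma nxt_neq a : (nxt a == pos a) = false.
Proof. by apply/eqP => /(congr1 rank); rewrite rank_nxt rank_pos; lia. Qed.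

Definition signed_swap c d x : idx m :=
  if x == c then d else if x == d then c else
  if x == opp c then opp d else if x == opp d then opp c else x.

(** Describing sigma_a by its effect on the pair (a, nxt a) treats the sign
    change sigma_m together with the transpositions, and makes its conjugates
    easy to compute. *)
Lemma sigma_signed_swap a x : sigma a x = signed_swap (pos a) (nxt a) x.
Proof.
rewrite /sigma /signed_swap /nxt; case: ifPn => [_|/nextE hn].
  rewrite oppK; case: tpermP => [->|->|/eqP/negPf h1 /eqP/negPf h2].
  - by rewrite eqxx.
  - by rewrite opp_neq eqxx.
  - by rewrite h1 h2.
rewrite permM; case: (tpermP (pos a)) => [->|->|/eqP/negPf h1 /eqP/negPf h2].
- by rewrite eqxx tpermD.
- have -> : (pos (next a) == pos a) = false.
    by apply/eqP => -[] /(congr1 val) /=; rewrite hn; lia.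
  by rewrite eqxx tpermD.
rewrite h1 h2; case: tpermP => [->|->|/eqP/negPf h3 /eqP/negPf h4].
- by rewrite eqxx.
- have -> : (opp (pos (next a)) == opp (pos a)) = false.
    by apply/eqP => -[] /(congr1 val) /=; rewrite hn; lia.
  by rewrite eqxx.
- by rewrite h3 h4.
Qed.

Lemma sigma_pos a : sigma a (pos a) = nxt a.
Proof. by rewrite sigma_signed_swap /signed_swap eqxx. Qed.

Lemma sigma_nxt a : sigma a (nxt a) = pos a.
Proof. by rewrite sigma_signed_swap /signed_swap nxt_neq eqxx. Qed.

Lemma eq_oppl c d : (opp c == d) = (c == opp d).
Proof. by rewrite -(inj_eq opp_inj) oppK. Qed.

Lemma signed_swap_opp c d x : signed_swap c d (opp x) = opp (signed_swap c d x).
Proof.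
rewrite /signed_swap !eq_oppl !oppK.
have [->|_] := eqVneq x c; first by rewrite eq_sym opp_neq; case: eqP.
have [->|_] := eqVneq x d.
  by rewrite [d == opp d]eq_sym opp_neq; case: eqP.
by do 2?case: ifP; rewrite ?oppK.
Qed.

Lemma signed_swap_morph (f : idx m -> idx m) c d x :
  injective f -> (forall y, f (opp y) = opp (f y)) ->
  f (signed_swap c d x) = signed_swap (f c) (f d) (f x).
Proof.
move=> fI fo; rewrite /signed_swap -!fo !(inj_eq fI).
by do 4?case: ifP => _ //.
Qed.

Lemma signed_swap_oppC c d x : signed_swap (opp d) (opp c) x = signed_swap c d x.
Proof.
rewrite /signed_swap !oppK.
have [->|_] := eqVneq x (opp d).
  rewrite opp_neq (inj_eq opp_inj) eq_oppl.
  by case: eqP => [->|_]; rewrite ?oppK //; case: eqP => // ->.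
have [->|_] := eqVneq x (opp c); last by do 2?case: eqP => // ->.
by rewrite opp_neq eq_oppl; case: eqP => // ->; rewrite oppK.
Qed.

Lemma sigma_opp a c : sigma a (opp c) = opp (sigma a c).
Proof. by rewrite !sigma_signed_swap signed_swap_opp. Qed.

Lemma rank_sigma a c : rank (sigma a c) =
  if rank c == a then a.+1 else if rank c == a.+1 then a : nat else
  if (rank c).+1 == (m.*2 - a)%N then (m.*2 - a.+2)%N else
  if (rank c).+2 == (m.*2 - a)%N then (m.*2 - a.+1)%N else rank c.
Proof.
have ha := ltn_ord a; have hc := rank_lt c.
rewrite sigma_signed_swap /signed_swap -!(inj_eq rank_inj) !rank_opp rank_nxt rank_pos.
have -> : (rank c == m.*2 - a.+1)%N = ((rank c).+1 == m.*2 - a)%N by lia.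
have -> : (rank c == m.*2 - a.+2)%N = ((rank c).+2 == m.*2 - a)%N by lia.
by do 4?case: ifP => _; rewrite ?rank_opp ?rank_nxt ?rank_pos.
Qed.

Lemma sigmaK a : involutive (sigma a).
Proof.
move=> c; apply: rank_inj; have ha := ltn_ord a; have hc := rank_lt c.
by rewrite !rank_sigma; do 8?case: ifP; lia.
Qed.

Lemma sigmaV a : ((sigma a)^-1 = sigma a)%g.
Proof.
by apply/permP => c; apply: (@perm_inj _ (sigma a)); rewrite permKV sigmaK.
Qed.

(** A simple reflection makes only one positive root negative; here it is seen as
    a pair of neighbours, in either of its two forms. *)
Lemma sigma_rank_lt a c d : (rank c < rank d)%N ->
  [\/ (rank (sigma a c) < rank (sigma a d))%N,
      c = pos a /\ d = nxt a | c = opp (nxt a) /\ d = opp (pos a)].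
Proof.
have ha := ltn_ord a; have hc := rank_lt c; have hd := rank_lt d => hcd.
have [h1|h1] := boolP ((rank c == a) && (rank d == a.+1)).
  by apply: Or32; split; apply: rank_inj; rewrite ?rank_nxt ?rank_pos; lia.
have [h2|h2] := boolP (((rank c).+2 == m.*2 - a) && ((rank d).+1 == m.*2 - a))%N.
  apply: Or33; split; apply: rank_inj; rewrite rank_opp ?rank_nxt ?rank_pos; lia.
by apply: Or31; rewrite !rank_sigma; do 8?case: ifP; lia.
Qed.

Definition word_perm w : {perm idx m} :=
  foldr (fun a p => (p * sigma a)%g) 1%g w.

Lemma word_permE w c : word_perm w c = foldr (fun a => sigma a) c w.
Proof. by elim: w => [|a w IH] /=; rewrite ?perm1 ?permM ?IH. Qed.

Lemma word_perm_cat v w x : word_perm (v ++ w) x = word_perm v (word_perm w x).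
Proof. by rewrite !word_permE foldr_cat. Qed.

Lemma word_permV_cons a w c :
  (word_perm (a :: w))^-1%g c = (word_perm w)^-1%g (sigma a c).
Proof. by rewrite /= invMg permM sigmaV. Qed.

Lemma word_perm_opp w c : word_perm w (opp c) = opp (word_perm w c).
Proof. by rewrite !word_permE; elim: w => //= a w ->; rewrite sigma_opp. Qed.

(** When the letters of w are applied to the pair (c, d) one after the other, the
    pair can change its order only at a letter that exchanges its two entries. *)
Lemma word_crossing w c d : (rank c < rank d)%N ->
  (rank ((word_perm w)^-1%g d) < rank ((word_perm w)^-1%g c))%N ->
  exists v1 b v2, w = v1 ++ b :: v2 /\
    ((word_perm v1 (pos b) = c /\ word_perm v1 (nxt b) = d) \/
     (word_perm v1 (pos b) = opp d /\ word_perm v1 (nxt b) = opp c)).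
Proof.
elim: w c d => [|a w IH] c d hcd; first by rewrite invg1 !perm1; lia.
have hnil x : word_perm [::] x = x by rewrite perm1.
case: (sigma_rank_lt a hcd) => [hlt|[-> ->]|[-> ->]].
- rewrite !word_permV_cons => /(IH _ _ hlt)[v1 [b [v2 [-> hv]]]].
  exists (a :: v1), b, v2; split=> //; rewrite !permM.
  by case: hv => [] [-> ->]; rewrite ?sigma_opp !sigmaK; [left | right].
- by exists [::], a, w; split=> //; left; rewrite !hnil.
- by exists [::], a, w; split=> //; right; rewrite !hnil !oppK.
Qed.

(** The exchange condition: if the inverse of v sent the root eta_a to a negative
    one, then eta_a would be crossed at a letter b of v, and deleting both
    a and b would leave the product unchanged and lower the cost. For so_(2m)
    the letter a is not m, so it contributes to the cost. *)
Lemma minimal_word_positive (G : gtype) (s : {perm idx m}) u a v :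
  min_word G (u ++ a :: v) s -> (G = GSp -> ~~ is_last a) ->
  (rank ((word_perm v)^-1%g (pos a)) < rank ((word_perm v)^-1%g (nxt a)))%N.
Proof.
move=> [hw hmin] hG; rewrite ltnNge leq_eqVlt negb_or; apply/andP; split.
  by rewrite (inj_eq rank_inj) (inj_eq perm_inj) nxt_neq.
apply/negP => hlt.
have [|v1 [b [v2 [ev hv]]]] := word_crossing _ hlt.
  by rewrite rank_nxt rank_pos.
have cross x : sigma a (word_perm v1 (sigma b x)) = word_perm v1 x.
  apply: (@perm_inj _ (sigma a)); rewrite sigmaK [RHS]sigma_signed_swap.
  rewrite sigma_signed_swap (signed_swap_morph _ _ _ perm_inj (word_perm_opp v1)).
  by case: hv => [] [-> ->]; rewrite ?signed_swap_oppC.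
have : (word_cost G (u ++ a :: v) <= word_cost G (u ++ v1 ++ v2))%N.
  apply: hmin => c; rewrite hw ev !foldr_cat /= -!word_permE.
  by rewrite word_perm_cat /= permM cross.
rewrite ev /word_cost; case: (G) hG => [_|/(_ erefl) ha].
  by rewrite !size_cat /= size_cat /=; lia.
by rewrite !count_cat /= count_cat /= ha; lia.
Qed.

End SignedPermutations.

(** * Weights and sign sequences *)

Section Weights.
Variables (K : numFieldType) (G : gtype) (m : nat).
Implicit Types (a b : 'I_m) (c d : idx m) (mu nu : 'rV[K]_m).

(** The label mu_c for a signed index c, with mu_(-a) = - mu_a. *)
Definition coord mu c : K := (-1) ^+ c.1 * mu 0 c.2.

Definition dcoord (delta : 'I_m -> int) c : int := (-1) ^+ c.1 * delta c.2.

Lemma coord_opp mu c : coord mu (opp c) = - coord mu c.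
Proof. by case: c => [[] a]; rewrite /coord /= ?expr0 ?expr1 ?mul1r ?mulN1r ?opprK. Qed.

Lemma coord_pos mu a : coord mu (pos a) = mu 0 a.
Proof. by rewrite /coord expr0 mul1r. Qed.

Lemma dcoord_opp delta c : dcoord delta (opp c) = - dcoord delta c.
Proof. by case: c => [[] a]; rewrite /dcoord /= ?expr0 ?expr1 ?mul1r ?mulN1r ?opprK. Qed.

Lemma wactE (s : {perm idx m}) mu b :
  (forall c, s (opp c) = opp (s c)) -> wact s mu 0 b = coord mu ((s^-1)%g (pos b)).
Proof.
move=> hs; rewrite /wact summxE; set c := (s^-1)%g (pos b).
have sc : s c = pos b by rewrite permKV.
rewrite (bigD1 c.2) //= big1 ?addr0 => [|a ha]; rewrite !mxE.
  rewrite /coord mulrC; congr (_ * _).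
  case: c sc => [[] a] /= sc; rewrite /pos ?sc /= ?eqxx ?mulr1 //.
  by rewrite -[(false, a)]/(opp (true, a)) hs sc eqxx mulr1.
rewrite (_ : b == _ = false) ?andbF ?mulr0 //.
apply: contraNF ha => /eqP hb.
have [h|h] : s (pos a) = pos b \/ s (pos a) = opp (pos b).
  by case: (s _) hb => [[] a'] /= <-; [right | left].
- by rewrite /c -h permK.
- by rewrite /c -[pos b]oppK -h -hs permK.
Qed.

Lemma coord_wact (s : {perm idx m}) mu c :
  (forall c, s (opp c) = opp (s c)) -> coord (wact s mu) c = coord mu ((s^-1)%g c).
Proof.
move=> hs; have hV d : (s^-1)%g (opp d) = opp ((s^-1)%g d).
  by apply: (@perm_inj _ s); rewrite hs !permKV.
case: c => [[] a]; rewrite {1}/coord /= wactE // ?expr0 ?expr1 ?mul1r //.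
by rewrite mulN1r -coord_opp -hV.
Qed.

Lemma row_coordP mu nu : (forall c, coord mu c = coord nu c) -> mu = nu.
Proof. by move=> h; apply/rowP => a; have := h (pos a); rewrite !coord_pos. Qed.

Lemma shifted_act_cons a w mu :
  shifted_act G (word_perm (a :: w)) mu =
  shifted_act G (sigma a) (shifted_act G (word_perm w) mu).
Proof.
rewrite /shifted_act subrK; congr (_ - _); apply: row_coordP => c.
rewrite !coord_wact; [|exact: word_perm_opp|exact: sigma_opp|exact: word_perm_opp].
by rewrite word_permV_cons sigmaV.
Qed.

Lemma dactE (s : {perm idx m}) delta a :
  dact s delta a = dcoord delta ((s^-1)%g (pos a)).
Proof. by []. Qed.

Lemma dcoord_dact (s : {perm idx m}) delta c :
  (forall c, s (opp c) = opp (s c)) ->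
  dcoord (dact s delta) c = dcoord delta ((s^-1)%g c).
Proof.
move=> hs; have hV d : (s^-1)%g (opp d) = opp ((s^-1)%g d).
  by apply: (@perm_inj _ s); rewrite hs !permKV.
case: c => [[] a]; rewrite {1}/dcoord dactE /= ?expr0 ?expr1 ?mul1r //.
by rewrite mulN1r -dcoord_opp -hV.
Qed.

Lemma dact_cons a w delta :
  dact (word_perm (a :: w)) delta = dact (sigma a) (dact (word_perm w) delta).
Proof.
apply/funext => b; rewrite !dactE dcoord_dact; last exact: word_perm_opp.
by rewrite word_permV_cons sigmaV.
Qed.

(** The integer labels of the simple root eta_a; the last term contributes for
    the long root, where nxt a = - a. *)
Definition etaz a b : int :=
  (pos b == pos a)%:Z - (pos b == nxt a)%:Z + (pos b == opp (nxt a))%:Z.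

Lemma eta_etaz a b : eta K a 0 b = (etaz a b)%:~R.
Proof.
rewrite /eta /etaz /nxt; case: ifPn => [_|ha]; rewrite !mxE /= ?oppK.
  rewrite expr0 mul1r; case: eqVneq => [->|h].
    by rewrite !eqxx /= mulr1.
  have -> : (pos b == pos a) = false by apply: contraNF h => /eqP[->].
  by rewrite mulr0.
rewrite !expr0 !mul1r /pos /opp /= !xpair_eqE /= addr0.
by rewrite intrB.
Qed.

Lemma rhoE b : rho K G m 0 b = (m - b.+1)%:R + (if G is GO then 1 else 0).
Proof.
rewrite /rho mxE [X in _ * X]mxE mulrDr; congr (_ + _); last first.
  case: G; rewrite ?mxE ?mulr0 //.
  rewrite summxE (bigD1 b) //= big1 => [|a ha]; rewrite !mxE /= expr0 mul1r.
    by rewrite !eqxx mulr1 addr0 mulVf // pnatr_eq0.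
  by rewrite (negPf (_ : b != a)) ?mulr0 // eq_sym.
have step a (c : 'I_m) :
    (eps K (pos a) - eps K (pos c) + (eps K (pos a) + eps K (pos c))) 0 b =
    2 * (a == b)%:R.
  by rewrite addrACA addNr addr0 !mxE /= !expr0 !mul1r eq_sym mulr_natl mulr2n.
rewrite summxE (bigD1 b) //= [X in _ + X]big1 ?addr0 => [|a ha]; last first.
  by rewrite summxE big1 // => c _; rewrite step (negPf ha) mulr0.
rewrite summxE (eq_bigr (fun=> 2)) => [|c _]; last by rewrite step eqxx mulr1.
rewrite sumr_const -[_ *+ #|_|]mulr_natr mulrA mulVf ?mul1r ?pnatr_eq0 //; congr _%:R.
rewrite -sum1_card -(big_mkord (fun k => b < k)%N (fun=> 1%N)).
rewrite big_mkcond /=; move: (b : nat) => l; elim: (m) => [|k IH]; first by rewrite big_geq.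
by rewrite big_nat_recr //= IH; case: ifP; lia.
Qed.

(** The reflection in a simple root eta lowers the half-sum of positive roots by
    eta; but sigma_m is not a reflection in a root of so_(2m), and it fixes
    rho there. *)
Lemma shifted_act_sigma a mu :
  shifted_act G (sigma a) mu =
  wact (sigma a) mu -
  (if (if G is GSp then is_last a else false) then 0 else eta K a).
Proof.
have hrho : wact (sigma a) (rho K G m) - rho K G m =
    - (if (if G is GSp then is_last a else false) then 0 else eta K a).
  apply/rowP => b; rewrite [LHS]mxE wactE ?sigmaV; last exact: sigma_opp.
  have -> : (- (if (if G is GSp then is_last a else false) then 0 else eta K a)) 0 b =
     - (if (if G is GSp then is_last a else false) then 0 else (etaz a b)%:~R).
    by case: ifP; rewrite !mxE // eta_etaz.
  have hb := ltn_ord b; have ha := ltn_ord a; rewrite [in LHS]mxE.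
  have [->|nba] := eqVneq b a.
    rewrite sigma_pos /nxt /etaz /nxt eqxx.
    case: ifPn => hl; rewrite ?coord_opp coord_pos !rhoE.
      have -> : (m - a.+1)%N = 0%N by move: hl; rewrite /is_last; lia.
      rewrite oppK eqxx [pos a == _]eq_sym opp_neq !add0r.
      by case: (G); rewrite ?oppr0 ?addr0 // -opprD.
    rewrite (nextE hl) ![pos a == _]eq_sym [opp _ == _]eq_sym.
    have -> : (pos (next a) == pos a) = false.
      by apply/eqP => -[] /(congr1 val) /=; rewrite (nextE hl); lia.
    rewrite addr0 subr0 -[(m - a.+1)%N]prednK; last by move: hl; rewrite /is_last; lia.
    rewrite (_ : (m - a.+2)%N = (m - a.+1).-1); last by lia.
    by rewrite opprD addrACA subrr addr0 -natr1 opprD addNKr; case: (G).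
  have h1 : (pos b == pos a) = false by apply: contraNF nba => /eqP[->].
  rewrite sigma_signed_swap /signed_swap /etaz h1.
  have [h2|h2] := eqVneq (pos b) (nxt a).
    have hl : ~~ is_last a.
      by move: h2; rewrite /nxt; case: ifP.
    have eb : b = a.+1 :> nat.
      by have := congr1 (@rank m) h2; rewrite rank_nxt rank_pos.
    rewrite h2 [nxt a == _]eq_sym opp_neq coord_pos !rhoE eb (negPf hl).
    rewrite -[(m - a.+1)%N]prednK; last by lia.
    rewrite (_ : (m - a.+2)%N = (m - a.+1).-1); last by lia.
    rewrite opprD addrACA subrr addr0 -natr1 addrAC subrr add0r.
    by case: (G); rewrite /= opprK.
  have [h3|_] := eqVneq (pos b) (opp (pos a)); first by case: h3.
  have [h4|_] := eqVneq (pos b) (opp (nxt a)).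
    move: h4 nba; rewrite /nxt; case: ifP => _ //.
    by rewrite oppK => -[->]; rewrite eqxx.
  by rewrite coord_pos subrr; case: ifP; rewrite oppr0.
rewrite /shifted_act -hrho addrA; congr (_ - _); apply/rowP => b.
by rewrite [RHS]mxE !wactE; try exact: sigma_opp; rewrite /coord mxE mulrDr.
Qed.

End Weights.

(** * Brackets and left ideals *)

Section Commutators.
Variable A : pzRingType.
Implicit Types x y z : A.

Lemma bracketD x : {morph commr x : y z / y + z}.
Proof. by move=> y z; rewrite /commr mulrDr mulrDl opprD addrACA. Qed.

Lemma bracket0 x : commr x 0 = 0.
Proof. by rewrite /commr mulr0 mul0r subrr. Qed.

Lemma bracketN x : {morph commr x : y / - y}.
Proof. by move=> y; rewrite /commr mulrN mulNr opprD. Qed.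

Lemma bracketB x : {morph commr x : y z / y - z}.
Proof. by move=> y z; rewrite bracketD bracketN. Qed.

Lemma bracketMn x y i : commr x (y *+ i) = commr x y *+ i.
Proof. by elim: i => [|i IH]; rewrite ?bracket0 // !mulrS bracketD IH. Qed.

Lemma bracket_sum x (I : finType) (f : I -> A) :
  commr x (\sum_i f i) = \sum_i commr x (f i).
Proof. exact: (big_morph _ (bracketD x) (bracket0 x)). Qed.

Lemma bracketM x y z : commr x (y * z) = commr x y * z + y * commr x z.
Proof. by rewrite /commr mulrBl mulrBr !mulrA subrKA. Qed.

Lemma bracketC x y : commr x y = - commr y x.
Proof. by rewrite /commr opprB. Qed.

Lemma mulr_bracket x y : x * y = y * x + commr x y.
Proof. by rewrite /commr addrC subrK. Qed.

End Commutators.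

Section ScalarCommutators.
Variables (K : comNzRingType) (A : kAlg K).
Implicit Types (x y : A) (k : K).

Lemma bracket_kst x k : commr x (kst A k) = 0.
Proof. by rewrite /commr kstC subrr. Qed.

Lemma bracketZ x k y : commr x (kst A k * y) = kst A k * commr x y.
Proof. by rewrite bracketM bracket_kst mul0r add0r. Qed.

Lemma bracketZl x k y : commr (kst A k * x) y = kst A k * commr x y.
Proof. by rewrite bracketC bracketZ bracketC mulrN opprK. Qed.

End ScalarCommutators.

Section LeftIdeals.
Variable A : pzRingType.
Implicit Types (S : set A) (x y : A).

Lemma left_ideal_gen S x : S x -> left_ideal S x.
Proof.
move=> Sx; exists 1%N, (fun=> x); split=> [_|]; last by rewrite big_ord1.
by exists 1, x; rewrite mul1r.
Qed.

Lemma left_ideal_ind S (P : A -> Prop) :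
  P 0 -> (forall x y, P x -> P y -> P (x + y)) ->
  (forall y s, S s -> P (y * s)) -> forall x, left_ideal S x -> P x.
Proof.
move=> P0 PD PM x [k [u [hu ->]]]; apply: big_ind => // i _.
by have [y [s [Ss ->]]] := hu i; apply: PM.
Qed.

Lemma left_ideal0 S : left_ideal S 0.
Proof. by exists 0%N, (fun=> 0); split=> [[]//|]; rewrite big_ord0. Qed.

Lemma left_idealM S y x : left_ideal S x -> left_ideal S (y * x).
Proof.
move=> [k [u [hu ->]]]; exists k, (fun i => y * u i); split=> [i|].
  by have [z [s [Ss ->]]] := hu i; exists (y * z), s; rewrite mulrA.
by rewrite mulr_sumr.
Qed.

Lemma fin_sumsD (V : zmodType) (T : set V) (x y : V) :
  fin_sums T x -> fin_sums T y -> fin_sums T (x + y).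
Proof.
move=> [k [u [hu ->]]] [l [v [hv ->]]].
exists (k + l)%N, (fun i => match fintype.split i with
                            | inl i => u i | inr j => v j end); split=> [i|].
  by case: (fintype.split i).
rewrite big_split_ord /=; congr (_ + _); apply: eq_bigr => i _.
  by rewrite (unsplitK (inl i : 'I_k + 'I_l)).
by rewrite (unsplitK (inr i : 'I_k + 'I_l)).
Qed.

Lemma left_idealD S x y : left_ideal S x -> left_ideal S y -> left_ideal S (x + y).
Proof. exact: fin_sumsD. Qed.

Lemma left_idealN S x : left_ideal S x -> left_ideal S (- x).
Proof. by rewrite -mulN1r; apply: left_idealM. Qed.

Lemma left_idealB S x y : left_ideal S x -> left_ideal S y -> left_ideal S (x - y).
Proof. by move=> hx hy; apply: left_idealD => //; apply: left_idealN. Qed.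

Lemma left_ideal_sum S (I : finType) (f : I -> A) :
  (forall i, left_ideal S (f i)) -> left_ideal S (\sum_i f i).
Proof.
move=> h; apply: big_ind => // [|x y]; [exact: left_ideal0 | exact: left_idealD].
Qed.

Lemma left_ideal_sub S (T : set A) x :
  (forall y, S y -> left_ideal T y) -> left_ideal S x -> left_ideal T x.
Proof.
move=> h; apply: left_ideal_ind => [|y z|y s /h]; first exact: left_ideal0.
  exact: left_idealD.
exact: left_idealM.
Qed.

End LeftIdeals.

(** * The two dual pairs in uniform notation *)

Section Signs.
Variables (K : numFieldType) (G : gtype) (m n : nat).
Local Notation theta := (theta K G).
Local Notation veps := (veps K G).
Implicit Types (c d : idx m) (i : 'I_n).

(** The sign of the invariant form on C^(2m): for O_n it is the alternating form
    of sp_(2m), for Sp_n the symmetric form of so_(2m). *)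
Definition gsign : K := if G is GO then -1 else 1.

Lemma gsign2 : gsign * gsign = 1.
Proof. by rewrite /gsign; case: G; rewrite ?mulrNN mulr1. Qed.

Lemma gsignX2 (b : bool) : gsign ^+ b * gsign ^+ b = 1.
Proof. by case: b; rewrite ?expr1 ?gsign2 // mulr1. Qed.

Lemma gsignXN (b : bool) : gsign ^+ (~~ b) = gsign * gsign ^+ b.
Proof. by case: b; rewrite /= ?expr1 ?gsign2 ?mulr1. Qed.

Lemma vepsE c d : veps c d = gsign ^+ c.1 * gsign ^+ d.1.
Proof. by rewrite /veps /gsign; case: G; rewrite ?expr1n ?mulr1. Qed.

Lemma veps2 c d : veps c d * veps c d = 1.
Proof. by rewrite vepsE mulrACA !gsignX2 mulr1. Qed.

Lemma veps_opp c d : veps (opp d) (opp c) = veps c d.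
Proof. by rewrite !vepsE /= !gsignXN mulrACA gsign2 mul1r mulrC. Qed.

Lemma tilde_val i : tilde i = (if odd i then i.-1 else if (i.+1 < n)%N then i.+1 else i) :> nat.
Proof.
rewrite /tilde val_insubd; have := ltn_ord i.
by case: (odd i) => // hi; case: ifP => //; lia.
Qed.

Lemma tildeK : involutive (@tilde n).
Proof.
by move=> i; apply: val_inj => /=; rewrite !tilde_val; have := ltn_ord i; do !case: ifP; lia.
Qed.

Lemma theta2 i : theta i * theta i = 1.
Proof. by rewrite /theta; case: G; rewrite ?mulr1 // -expr2 sqrr_sign. Qed.

Hypothesis hG : G = GSp -> ~~ odd n.

Lemma theta_tilde i : theta (tilde i) = - gsign * theta i.
Proof.
rewrite /theta /gsign; case: G hG => [_|/(_ erefl) hn]; first by rewrite opprK mulr1.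
rewrite mulN1r -signr_odd -[in RHS]signr_odd tilde_val.
have := ltn_ord i; case: ifP => ho hi.
  have -> : odd i.-1 = false by lia.
  by rewrite expr1 opprK expr0.
case: ifP => h2; first by rewrite /= ho /= expr1 expr0.
by move: hn ho h2 hi; lia.
Qed.

Lemma theta_mul_tilde i : theta i * theta (tilde i) = - gsign.
Proof. by rewrite theta_tilde mulrCA theta2 mulr1. Qed.

Lemma reindex_tilde (V : zmodType) (f : 'I_n -> V) : \sum_k f k = \sum_k f (tilde k).
Proof. by rewrite (reindex_inj (inv_inj tildeK)). Qed.

End Signs.

(** Decides identities between products of signs gsign ^+ c.1 by running through
    all cases. *)
Ltac sign_eq :=
  rewrite ?vepsE /=;
  repeat match goal with
  | |- context [GRing.exp ?x (nat_of_bool (fst ?c))] => case: (fst c)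
  | |- context [nat_of_bool (~~ fst ?c)] => case: (fst c)
  end;
  rewrite /= /gsign;
  match goal with
  | |- context [match ?g with GO => _ | GSp => _ end] => case: g
  end;
  rewrite /= ?expr0 ?expr1 ?(mul1r, mulr1, mulN1r, mulrN1, opprK) //.

Section Relations.
Variables (K : numFieldType) (G : gtype) (m n : nat).
Hypothesis hG : G = GSp -> ~~ odd n.
Variables (B : kAlg K) (F : idx m -> idx m -> B) (x d : 'I_m -> 'I_n -> B).
Hypotheses (hU : U_rels G F) (hPD : PD_rels x d) (hX : cross_rels G F x d).
Local Notation ks := (kst B).
Local Notation zeta := (zeta G x d).
Local Notation theta := (theta K G).
Local Notation veps := (veps K G).
Local Notation gsign := (gsign K G).
Implicit Types (a b c e : idx m) (i j k : 'I_n).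

(** The normalization by theta makes the span of the Q c i, for fixed i, a copy
    of the defining representation of f_m (bracket_F_Q). In these elements the
    four formulas for zeta become one (zetaE), and so do those for the action of
    the braid group. *)
Definition Q c i : B :=
  if c.1 then ks (theta (tilde i)) * d c.2 (tilde i) else x c.2 i.

Lemma d_Q (a : 'I_m) i : d a i = ks (theta i) * Q (opp (pos a)) (tilde i).
Proof. by rewrite /Q /= tildeK mulrA -rmorphM theta2 rmorph1 mul1r. Qed.

(** The value of the skew form on the generators of the Weyl algebra. *)
Definition omega c i e j : K :=
  ((e == opp c) && (i == tilde j))%:R * (gsign ^+ (~~ c.1) * theta j).

Lemma bracket_Q c i e j : commr (Q c i) (Q e j) = ks (omega c i e j).
Proof.
have eqt : (i == tilde j) = (tilde i == j) by rewrite -(inj_eq (inv_inj (@tildeK n))) tildeK.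
case: c e => [[] a] [[] b]; rewrite /Q /omega /= ?xpair_eqE /=.
- rewrite bracketZ bracketZl; have [_ -> _] := hPD a b (tilde i) (tilde j).
  by rewrite !mulr0 mul0r rmorph0.
- rewrite bracketZl expr0 mul1r; have [_ _ ->] := hPD a b (tilde i) j.
  rewrite [b == a]eq_sym eqt; case: andP => [[_ /eqP <-]|_]; last first.
    by rewrite !(mulr0, mul0r) rmorph0.
  by rewrite mulr1 mul1r.
- rewrite bracketC bracketZl expr1; have [_ _ ->] := hPD b a (tilde j) i.
  rewrite [i == _]eq_sym; case: andP => _; last by rewrite mulr0 mul0r rmorph0 oppr0.
  by rewrite mulr1 mul1r (theta_tilde _ hG) mulNr rmorphN opprK.
- by have [-> _ _] := hPD a b i j; rewrite mul0r rmorph0.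
Qed.

Definition bilin c e : B := \sum_k ks (theta k) * Q c k * Q e (tilde k).

(** For indices of equal sign the constant n / 2 orders x and d symmetrically:
    bringing a product d x into the form x d changes n / 2 into - n / 2. *)
Lemma zetaE c e : zeta c e =
  ks ((c == e)%:R * (n%:R / 2)) + ks (gsign ^+ e.1) * bilin c (opp e).
Proof.
case: c e => [[] a] [[] b]; rewrite /bilin /zeta /zeta_pos /Q /= ?xpair_eqE /=.
- have e k : ks (theta k) * (ks (theta (tilde k)) * d a (tilde k)) * x b (tilde k) =
      - ks gsign * (d a (tilde k) * x b (tilde k)).
    by rewrite !mulrA -rmorphM (theta_mul_tilde _ hG) rmorphN.
  rewrite (eq_bigr _ (fun k _ => e k)) -mulr_sumr expr1 [ks gsign * _]mulrA mulrN.
  rewrite -rmorphM gsign2 rmorph1 mulN1r -(reindex_tilde (fun k => d a k * x b k)).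
  rewrite [in RHS](eq_bigr (fun k => x b k * d a k + (a == b)%:R)); last first.
    move=> k _; rewrite [LHS]mulr_bracket; have [_ _ ->] := hPD a b k k.
    by rewrite eqxx andbT.
  rewrite big_split /= sumr_const card_ord !opprD addrA addrAC; congr (_ + _).
  rewrite [b == a]eq_sym -(rmorph_nat ks) -rmorphMn -rmorphB -rmorphN; congr (ks _).
  case: (a == b); rewrite ?mul0r ?mul0rn ?subr0 ?oppr0 // !mul1r.
  by rewrite [X in _ - X](splitr n%:R) opprD addrA subrr add0r.
- rewrite mul0r rmorph0 add0r expr0 rmorph1 mul1r [RHS]reindex_tilde.
  apply: eq_bigr => k _; rewrite !tildeK [RHS]mulrA -[_ * _ * ks _]mulrA -kstC.
  by rewrite !mulrA -!rmorphM theta2 mul1r.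
- rewrite mul0r rmorph0 add0r [in RHS]reindex_tilde mulr_sumr -sumrN; apply: eq_bigr => k _.
  rewrite tildeK !mulrA -rmorphM expr1 (theta_tilde _ hG) mulNr mulrN mulrA gsign2 mul1r.
  by rewrite rmorphN !mulNr.
- rewrite expr0 rmorph1 mul1r; congr (_ + _); apply: eq_bigr => k _.
  rewrite tildeK mulrA -[_ * _ * ks _]mulrA -kstC !mulrA -rmorphM theta2.
  by rewrite rmorph1 mul1r.
Qed.

Lemma bracket_F_Q a b c i : commr (F a b) (Q c i) =
  Q a i *+ (c == b) - ks (veps a b) * Q (opp b) i *+ (c == opp a).
Proof.
have -> : commr (F a b) (Q c i) = commr (zeta a b) (Q c i).
  rewrite /Q; case: ifP => _; rewrite ?bracketZ.
    by have [_ ->] := hX a b c.2 (tilde i).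
  by have [-> _] := hX a b c.2 i.
rewrite bracketC zetaE bracketD bracket_kst add0r bracketZ bracket_sum.
have e k : commr (Q c i) (ks (theta k) * Q a k * Q (opp b) (tilde k)) =
    ks (omega c i a k * theta k) * Q (opp b) (tilde k) +
    ks (omega c i (opp b) (tilde k) * theta k) * Q a k.
  rewrite bracketM bracketZ !bracket_Q // -[_ * Q a k * _]kstC mulrA -!rmorphM.
  by rewrite [theta k * _]mulrC.
rewrite (eq_bigr _ (fun k _ => e k)) big_split /= /omega.
rewrite (bigD1 (tilde i)) //= tildeK eqxx andbT big1 => [|k hk]; last first.
  rewrite (_ : i == tilde k = false) ?andbF ?mul0r ?rmorph0 ?mul0r //.
  by apply: contraNF hk => /eqP ->; rewrite tildeK.
rewrite (bigD1 i) //= tildeK eqxx andbT big1 => [|k hk]; last first.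
  by rewrite tildeK [i == k]eq_sym (negPf hk) andbF !mul0r rmorph0 mul0r.
rewrite !addr0 mulrDr opprD addrC !mulrA -!rmorphM (inj_eq (@opp_inj m)).
rewrite [c == b]eq_sym [c == _]eq_sym eq_oppl; congr (_ + _).
  case: eqVneq => [->|_]; last by rewrite !mul0r mulr0 rmorph0 mul0r oppr0.
  rewrite mul1r gsignXN -mulrA [theta (tilde i) * _]mulrC (theta_mul_tilde _ hG).
  rewrite mulrN mulrN mulrAC gsign2 mul1r gsignX2 rmorphN1 mulN1r opprK.
  by rewrite mulr1n.
case: eqVneq => [->|_]; last by rewrite !mul0r mulr0 rmorph0 mul0r oppr0.
by rewrite mul1r -!mulrA theta2 mulr1 vepsE mulrC mulr1n.
Qed.

Lemma bracket_F_bilin a b u v : commr (F a b) (bilin u v) =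
  (bilin a v *+ (u == b) - ks (veps a b) * bilin (opp b) v *+ (u == opp a)) +
  (bilin u a *+ (v == b) - ks (veps a b) * bilin u (opp b) *+ (v == opp a)).
Proof.
rewrite /bilin bracket_sum !mulr_sumr -!sumrMnl -!sumrB -big_split; apply: eq_bigr => k _ /=.
rewrite bracketM bracketZ !bracket_F_Q mulrBr mulrBl mulrBr.
rewrite !mulrnAr !mulrnAl !mulrA; congr (_ - _ *+ _ + (_ - _ *+ _)).
  by rewrite -!rmorphM mulrC.
by rewrite -[_ * ks _]kstC !mulrA.
Qed.

(** The right-hand side of the commutation relations of f_m. It is a function of
    the family Phi because the elements F, zeta(F) and F - zeta(F) all transform
    under the bracket with F by the same rule. *)
Definition adj (Phi : idx m -> idx m -> B) a b c e : B :=
  Phi a e *+ (c == b) - ks (veps a b) * Phi (opp b) e *+ (c == opp a)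
  - Phi c b *+ (e == a) + ks (veps a b) * Phi c (opp a) *+ (e == opp b).

Lemma bracket_F_zeta a b c e : commr (F a b) (zeta c e) = adj zeta a b c e.
Proof.
have cancel (V : zmodType) (k1 k2 x1 x2 x3 x4 : V) :
    k1 + x1 - (k2 + x2) - (k1 + x3) + (k2 + x4) = x1 - x2 + (x4 - x3).
  rewrite !opprD -addrA [k1 + x1 + _]addrACA [- k1 - x3 + _]addrACA [LHS]addrACA.
  by rewrite [- k1 + k2]addrC -[k2 - k1]opprB subrr add0r [- x3 + _]addrC.
rewrite /adj !zetaE bracketD bracket_kst add0r bracketZ bracket_F_bilin.
rewrite !eq_oppl oppK !mulrDr !mulrnDl ?oppK.
have -> : ks ((c == b)%:R * (n%:R / 2)) *+ (e == a) =
          ks ((a == e)%:R * (n%:R / 2)) *+ (c == b).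
  by rewrite [a == e]eq_sym; case: (c == b); case: (e == a); rewrite ?mul0r ?rmorph0 ?mul0rn.
have -> : (ks (veps a b) * ks ((c == opp a)%:R * (n%:R / 2))) *+ (e == opp b) =
          (ks (veps a b) * ks ((b == opp e)%:R * (n%:R / 2))) *+ (c == opp a).
  have -> : (b == opp e) = (e == opp b) by rewrite -eq_oppl eq_sym.
  by case: (c == _); case: (e == _);
    rewrite ?mul0r ?rmorph0 ?mulr0 ?mul0rn.
rewrite cancel !mulrN; congr (_ - _ + (_ - _)).
- by rewrite mulrnAr.
- by rewrite !mulrnAr mulrA kstC -mulrA.
- case: (eqVneq e _) => [->|_]; rewrite ?mulr0n ?mulr0 // !mulr1n [RHS]mulrA -rmorphM.
  by rewrite vepsE /= !gsignXN [gsign * _ ^+ a.1]mulrC mulrACA gsignX2 mul1r mulrC.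
- case: (eqVneq e _) => [->|_]; rewrite ?mulr0n ?mulr0 // !mulr1n [LHS]mulrA -rmorphM.
  by rewrite vepsE mulrA gsignX2 mul1r.
Qed.

(** The relations of U(f_m) are given by arrays of coefficients indexed by all
    pairs; sparse arrays are more conveniently written as lists of terms. *)
Definition lincomb (V : zmodType) (sc : K -> V -> V) (Phi : idx m -> idx m -> V)
    (l : seq (K * (idx m * idx m))) : V :=
  \sum_(t <- l) sc t.1 (Phi t.2.1 t.2.2).

Lemma lincombE (V : zmodType) (sc : K -> V -> V) (Phi : idx m -> idx m -> V) l :
  (forall (k k' : K) v, sc (k + k') v = sc k v + sc k' v) ->
  \sum_a \sum_b sc (\sum_(t <- l | t.2 == (a, b)) t.1) (Phi a b) = lincomb sc Phi l.
Proof.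
move=> scD; have sc0 v : sc 0 v = 0.
  by apply: (addrI (sc 0 v)); rewrite -scD !addr0.
elim: l => [|[k [c e]] l IH].
  by rewrite /lincomb big_nil big1 // => a _; rewrite big1 // => b _; rewrite big_nil.
rewrite /lincomb big_cons -/(lincomb sc Phi l) -IH /=.
under eq_bigr => a _ do under eq_bigr => b _ do
  rewrite big_cons /= -[if _ then _ else _]/(if _ then _ else _).
rewrite (eq_bigr (fun a => (if a == c then sc k (Phi a e) else 0) +
  \sum_b sc (\sum_(t <- l | t.2 == (a, b)) t.1) (Phi a b))); last first.
  move=> a _; rewrite (bigD1 e) //= [in RHS](bigD1 e) //= addrA; congr (_ + _).
    by rewrite xpair_eqE eqxx andbT [c == a]eq_sym; case: ifP; rewrite ?add0r ?scD.
  apply: eq_bigr => b hb; rewrite xpair_eqE [e == b]eq_sym (negPf hb) andbF //.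
rewrite big_split /= -big_mkcond big_pred1_eq //.
Qed.

Lemma F_rel l : lincomb *:%R (@Fmx K G m) l = 0 -> lincomb (fun k0 : K => *%R (ks k0)) F l = 0.
Proof.
move=> h; rewrite -lincombE => [|k0 k' v]; last by rewrite rmorphD mulrDl.
by apply: hU.1; rewrite (lincombE _ _ (fun (k0 k' : K) v => scalerDl v k0 k')).
Qed.

Lemma F_opp c e : F (opp e) (opp c) = - (ks (veps c e) * F c e).
Proof.
apply/eqP; rewrite -addr_eq0; apply/eqP.
have := @F_rel [:: (1, (opp e, opp c)); (veps c e, (c, e))].
rewrite /lincomb !big_cons !big_nil !addr0 rmorph1 mul1r; apply.
rewrite /Fmx veps_opp !oppK scale1r scalerBr scalerA veps2 scale1r.
by rewrite addrC subrKA subrr.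
Qed.

(** The form on C^n given by theta has the sign - gsign; the constant comes from
    n brackets of a d with its x. *)
Lemma bilin_sym u v : bilin u v =
  - (ks gsign * bilin v u) - ks (gsign ^+ u.1 * (n%:R *+ (v == opp u))).
Proof.
rewrite /bilin (eq_bigr (fun k => ks (theta k) * Q v (tilde k) * Q u k +
    ks (- (gsign ^+ u.1 * (1 *+ (v == opp u)))))) => [|k _]; last first.
  rewrite -[LHS]mulrA [Q u k * _]mulr_bracket mulrDr mulrA bracket_Q -rmorphM.
  congr (_ + ks _); rewrite /omega tildeK eqxx andbT.
  rewrite mulrCA [theta k * (_ * _)]mulrCA (theta_mul_tilde _ hG) gsignXN.
  by rewrite !mulrN mulrAC gsign2 mul1r mulrC.
rewrite big_split /= sumr_const card_ord reindex_tilde mulr_sumr -sumrN.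
congr (_ + _); last first.
  rewrite -rmorphMn -rmorphN; congr (ks _).
  rewrite mulNrn; congr (- _); case: (_ == _); rewrite ?mulr0n ?mulr0 ?mul0rn //.
  by rewrite !mulr1n mulr1 mulr_natr.
apply: eq_bigr => k _; rewrite tildeK theta_tilde // mulNr rmorphN rmorphM.
by rewrite !mulNr !mulrA.
Qed.

Lemma zeta_opp c e : zeta (opp e) (opp c) = - (ks (veps c e) * zeta c e).
Proof.
rewrite !zetaE oppK bilin_sym oppK mulrBr !mulrN (inj_eq (@opp_inj m)) mulrDr opprD.
rewrite addrCA addrC [e == c]eq_sym; congr (_ + _); last first.
  rewrite !mulrA -!rmorphM; congr (- (ks _ * _)); sign_eq.
rewrite -!rmorphM -rmorphB -rmorphN; congr (ks _).
case: eqVneq => [->|_]; last by rewrite !mul0r mulr0n !mulr0 subr0 oppr0.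
rewrite mulr1n !mul1r mulrA /= gsignX2 mul1r.
rewrite (_ : veps _ _ = 1) ?mul1r; last by rewrite vepsE gsignX2.
by rewrite [X in _ - X](splitr n%:R) opprD addrA subrr add0r.
Qed.

(** The bracket of F_ab with E_ce - veps E_(-e,-c) has eight terms; they pair up
    to the four generators in adj. *)
Lemma bracket_F_F a b c e : commr (F a b) (F c e) = adj F a b c e.
Proof.
pose l := [:: ((c == b)%:R, (a, e)); (- (veps a b * (c == opp a)%:R), (opp b, e));
  (- (e == a)%:R, (c, b)); (veps a b * (e == opp b)%:R, (c, opp a))]
  : seq (K * (idx m * idx m)).
have -> : adj F a b c e = lincomb (fun k0 : K => *%R (ks k0)) F l.
  rewrite /lincomb !big_cons big_nil addr0 /= /adj !rmorphN !mulNr !rmorphM !rmorph_nat.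
  by rewrite !mulr_natl !mulr_natr !mulrnAl !addrA.
rewrite -lincombE => [|k0 k' v]; last by rewrite rmorphD mulrDl.
apply: hU.2; rewrite (lincombE _ _ (fun (k0 k' : K) v => scalerDl v k0 k')).
rewrite /lincomb !big_cons big_nil addr0 /=.
have ixE u v : (ix u == ix v) = (u == v) by rewrite (inj_eq enum_rank_inj).
rewrite /Fmx !mulmxBl !mulmxBr -!scalemxAl -!scalemxAr !mul_delta_mx_cond !ixE.
have regroup (V : zmodType) (p1 p2 p3 p4 p5 p6 p7 p8 : V) :
    p1 - p2 - (p3 - p4) - (p5 - p6 - (p7 - p8)) =
    (p1 - p8) + (- (p3 - p7) + (- (p5 - p4) + (p6 - p2))).
  by rewrite !(opprD, opprK) !addrA [LHS](ACl (1*8*3*7*5*4*6*2)).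
have eq_oppr u v : (u == opp v) = (v == opp u) by rewrite -eq_oppl eq_sym.
rewrite regroup !eq_oppl !oppK [b == c]eq_sym [a == e]eq_sym.
rewrite [b == opp e]eq_oppr [a == opp c]eq_oppr.
congr (_ + (_ + (_ + _))).
- case: eqVneq => [->|_]; rewrite ?mulr0n ?scaler0 ?subrr ?scale0r // !mulr1n scale1r.
  by rewrite scalerA; congr (_ - _ *: _); sign_eq.
- case: eqVneq => [->|_]; rewrite ?mulr0n ?mulr0 ?oppr0 ?scaler0 ?subrr ?oppr0 ?scale0r //.
  rewrite !mulr1n mulr1 scaleNr scalerBr !scalerA.
  by congr (- (_ - _ *: _)); sign_eq.
- case: eqVneq => [->|_]; rewrite ?mulr0n ?mulr0 ?oppr0 ?scaler0 ?subrr ?oppr0 ?scale0r //.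
  by rewrite !mulr1n scaleN1r scalerA; congr (- (_ - _ *: _)); sign_eq.
- case: eqVneq => [->|_]; rewrite ?mulr0n ?mulr0 ?oppr0 ?scaler0 ?subrr ?oppr0 ?scale0r //.
  by rewrite !mulr1n mulr1 scalerBr !scalerA; congr (_ - _ *: _); sign_eq.
Qed.

End Relations.

(** * Root vectors of the simple roots *)

Section RingFacts.
Variable A : pzRingType.
Implicit Types u v w x y : A.

Lemma inverse_unique u v w : v * u = 1 -> u * w = 1 -> v = w.
Proof. by move=> h1 h2; rewrite -[v]mulr1 -h2 mulrA h1 mul1r. Qed.

Lemma rinvE u v : v * u = 1 -> u * v = 1 -> rinv u = v.
Proof.
move=> h1 h2; apply: (inverse_unique _ h2).
by have /(xgetPex 0)[] : exists y, y * u = 1 /\ u * y = 1 by exists v.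
Qed.

(** The identity of U(sl_2) behind all properties of Zhelobenko operators. *)
Lemma exp_sl2 (E F H : A) s : commr E F = H -> commr E H = - (E *+ 2) ->
  E ^+ s.+1 * F = F * E ^+ s.+1 + (s.+1)%:R * (H - s%:R) * E ^+ s.
Proof.
move=> hH hE; have EF : E * F = F * E + H by rewrite mulr_bracket hH.
have EH k : E * (H - k%:R) = (H - k.+2%:R) * E.
  rewrite mulrBr mulrBl mulr_natr mulr_natl mulr_bracket hE.
  by rewrite -addrA -opprD -mulrnDr add2n.
elim: s => [|s IH].
  by rewrite !expr1 expr0 !mulr1 subr0 mul1r.
rewrite exprS -mulrA IH mulrDr !mulrA EF mulrDl -!mulrA -addrA -exprS; congr (_ + _).
rewrite [E * _]mulrA [E * s.+1%:R]mulr_natr -mulr_natl -mulrA [E * _]mulrA EH.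
rewrite -!mulrA -exprS !mulrA -mulrDl; congr (_ * _).
rewrite !mulrBr -!natrM [in RHS]mulrSr mulrDl mul1r addrC addrAC.
by rewrite mulnC.
Qed.

End RingFacts.

Section SimpleRootVectors.
Variables (K : numFieldType) (G : gtype) (m n : nat).
Hypothesis hG : G = GSp -> ~~ odd n.
Local Notation B := (Bm K G m n).
Local Notation ks := (kst B).
Local Notation veps := (veps K G).
Implicit Types (a b : 'I_m) (c d e : idx m).

Definition Bm_U : U_rels G (BF K G n) := let: And3 h _ _ := Bm_rels K G m n in h.
Definition Bm_PD : PD_rels (@Bx K G m n) (@Bd K G m n) :=
  let: And3 _ h _ := Bm_rels K G m n in h.
Definition Bm_cross : cross_rels G (BF K G n) (@Bx K G m n) (@Bd K G m n) :=
  let: And3 _ _ h := Bm_rels K G m n in h.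

(** The generators in the labelling by weights: n' is now spanned by the Fo c e
    with rank c < rank e, and Do c e is the copy of Fo c e that commutes with the
    Weyl algebra. *)
Definition Fo c e : B := BF K G n (obar c) (obar e).
Definition Zo c e : B := Bzeta K G n (obar c) (obar e).
Definition Qo c i : B := Q G (@Bx K G m n) (@Bd K G m n) (obar c) i.

Lemma veps_obar c e : veps (obar c) (obar e) = veps c e.
Proof. by rewrite !vepsE /= !gsignXN mulrACA gsign2 mul1r. Qed.

Lemma Fo_opp c e : Fo (opp e) (opp c) = - (ks (veps c e) * Fo c e).
Proof. by rewrite /Fo !obar_opp (F_opp Bm_U) veps_obar. Qed.

Lemma Zo_opp c e : Zo (opp e) (opp c) = - (ks (veps c e) * Zo c e).
Proof. by rewrite /Zo /Bzeta !obar_opp (zeta_opp hG Bm_PD) veps_obar. Qed.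

Lemma adj_obar Phi c e c' e' : adj G Phi (obar c) (obar e) (obar c') (obar e') =
  adj G (fun c e => Phi (obar c) (obar e) : B) c e c' e'.
Proof. by rewrite /adj veps_obar -!obar_opp !(inj_eq (@obar_inj m)). Qed.

Lemma bracket_Fo_Fo u v c e : commr (Fo u v) (Fo c e) = adj G Fo u v c e.
Proof. by rewrite /Fo (bracket_F_F Bm_U) adj_obar. Qed.

Lemma bracket_Fo_Zo u v c e : commr (Fo u v) (Zo c e) = adj G Zo u v c e.
Proof. by rewrite /Fo /Zo /Bzeta (bracket_F_zeta hG Bm_PD Bm_cross) adj_obar. Qed.

Lemma bracket_Fo_Qo u v c i : commr (Fo u v) (Qo c i) =
  Qo u i *+ (c == v) - ks (veps u v) * Qo (opp v) i *+ (c == opp u).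
Proof.
by rewrite /Fo /Qo (bracket_F_Q hG Bm_PD Bm_cross) veps_obar -!obar_opp !(inj_eq (@obar_inj m)).
Qed.

Definition Do c e : B := Fo c e - Zo c e.

Lemma Do_opp c e : Do (opp e) (opp c) = - (ks (veps c e) * Do c e).
Proof. by rewrite /Do Fo_opp Zo_opp mulrBr !opprD. Qed.

Lemma bracket_Fo_Do u v c e : commr (Fo u v) (Do c e) = adj G Do u v c e.
Proof.
rewrite bracketB bracket_Fo_Fo bracket_Fo_Zo /adj /Do !mulrBr !mulrnBl !(opprD, opprK) !addrA.
by rewrite [LHS](ACl (1*5*2*6*3*7*4*8)).
Qed.

(** The weight of the root vector Fo u v on the diagonal element Fo c c. *)
Definition root_weight u v c : int :=
  (c == v)%:Z + (c == opp u)%:Z - (c == u)%:Z - (c == opp v)%:Z.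

Lemma adj_diag (Phi : idx m -> idx m -> B) u v c :
  (forall c e, Phi (opp e) (opp c) = - (ks (veps c e) * Phi c e)) ->
  adj G Phi u v c c = Phi u v *~ root_weight u v c.
Proof.
move=> hPhi; rewrite /adj /root_weight !mulrzBr mulrzDr -!pmulrn.
congr (_ + _ - _ + _).
- by case: eqVneq => // ->.
- case: eqVneq => [->|_]; rewrite ?oppr0 //.
  by rewrite hPhi mulrN opprK mulrA -rmorphM veps2 rmorph1 mul1r.
- by case: eqVneq => // ->.
- case: eqVneq => [->|_]; rewrite ?oppr0 //.
  by rewrite hPhi mulrN mulrA -rmorphM veps2 rmorph1 mul1r.
Qed.

(** The normalization of E_a and F_a. *)
Definition rootc a : K := if is_last a then 2^-1 else 1.

Lemma F_rootE a : F_ K G n a = ks (rootc a) * Fo (nxt a) (pos a).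
Proof.
rewrite /F_ /rootc /nxt /Fo /obar; case: ifP => _; rewrite ?bar_opp ?oppK //.
by rewrite rmorph1 mul1r.
Qed.

Lemma E_rootE a : E_ K G n a = ks (rootc a) * Fo (pos a) (nxt a).
Proof.
rewrite /E_ /rootc /nxt /Fo /obar; case: ifP => _; rewrite ?bar_opp ?oppK //.
by rewrite rmorph1 mul1r.
Qed.

Lemma Bh_Fo a : Bh K G n a = Fo (pos a) (pos a).
Proof. by []. Qed.

Lemma root_weight_F a b : root_weight (nxt a) (pos a) (pos b) = etaz a b.
Proof. by rewrite /root_weight /etaz -[opp (pos a)]/(true, a) subr0 addrAC. Qed.

Lemma root_weight_E a b : root_weight (pos a) (nxt a) (pos b) = - etaz a b.
Proof.
by rewrite /root_weight /etaz -[opp (pos a)]/(true, a) /= addr0 !opprD opprK [- _ + _]addrC.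
Qed.

Lemma bracket_F_Bh a b : commr (F_ K G n a) (Bh K G n b) = F_ K G n a *~ etaz a b.
Proof.
rewrite F_rootE bracketZl bracket_Fo_Fo adj_diag => [|c e]; last exact: Fo_opp.
by rewrite root_weight_F mulrzAr.
Qed.

Lemma bracket_E_Bh a b : commr (E_ K G n a) (Bh K G n b) = - (E_ K G n a *~ etaz a b).
Proof.
rewrite E_rootE bracketZl bracket_Fo_Fo adj_diag => [|c e]; last exact: Fo_opp.
by rewrite root_weight_E mulrNz mulrN mulrzAr.
Qed.

Section NotLastSp.
Variable a : 'I_m.
Hypothesis ha : G = GSp -> ~~ is_last a.

(** For a = m in type C the four terms of the bracket of F_(-1,1) and F_(1,-1)
    all equal F_(-1,-1), whence the normalization by 1 / 2. *)
Lemma bracket_E_F : commr (E_ K G n a) (F_ K G n a) = H_ K G n a.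
Proof.
rewrite E_rootE F_rootE bracketZl bracketZ bracket_Fo_Fo /adj !eqxx /H_ /rootc !Bh_Fo.
case hl: (is_last a); rewrite /nxt hl !mulr1n.
  have -> : veps (pos a) (opp (pos a)) = -1.
    rewrite /Defs.veps /= expr0 expr1 mul1r.
    by case: (G) ha => [//|/(_ erefl)]; rewrite hl.
  rewrite oppK !eqxx !mulr1n (_ : Fo (opp (pos a)) (opp (pos a)) = - Fo (pos a) (pos a)).
    rewrite rmorphN1 !mulN1r !opprK; set X := Fo _ _.
    have -> : X + X + X + X = ks 4%:R * X.
      by rewrite rmorph_nat mulr_natl !mulrSr mulr0n add0r.
    rewrite !mulrA -!rmorphM -invfM -natrM mulVf ?pnatr_eq0 //.
    by rewrite rmorph1 mul1r.
  by rewrite Fo_opp vepsE gsignX2 rmorph1 mul1r.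
by rewrite rmorph1 !mul1r /pos /opp /= !mulr0n subr0 addr0.
Qed.

Lemma bracket_E_H : commr (E_ K G n a) (H_ K G n a) = - (E_ K G n a *+ 2).
Proof.
rewrite /H_; case: ifP => hl; rewrite ?bracketB !bracket_E_Bh /etaz /nxt hl.
  by rewrite oppK eqxx.
have hne : (pos (next a) == pos a) = false.
  by apply/eqP => -[] /(congr1 val) /=; rewrite (nextE (negbT hl)) => h; clear ha hG; lia.
rewrite !eqxx [pos a == pos _]eq_sym hne opprK.
by transitivity (- E_ K G n a - E_ K G n a); rewrite -?opprD.
Qed.

End NotLastSp.

End SimpleRootVectors.

(** * Fractions of the Cartan subalgebra *)

Section Fractions.
Variables (K : numFieldType) (G : gtype) (m n : nat).
Local Notation B := (Bm K G m n).
Local Notation L := (Bbar K G m n).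
Local Notation io := (@iota_B K G m n).
Local Notation he := (@hexpr_B K G m n).
Local Notation ks := (kst B).
Local Notation hexpr := (hexpr K G m).
Implicit Types (a b : 'I_m) (c d e : idx m) (X : hexpr) (u v : B).

Lemma iota_morph : alg_morph io.
Proof. exact: (loc_relsP (den_B K n)).1. Qed.

Lemma iotaD : {morph io : u v / u + v}. Proof. exact: alg_morphD iota_morph. Qed.
Lemma iotaM : {morph io : u v / u * v}. Proof. exact: alg_morphM iota_morph. Qed.
Lemma iotaN : {morph io : u / - u}. Proof. exact: alg_morphN iota_morph. Qed.
Lemma iotaB : {morph io : u v / u - v}. Proof. by move=> u v; rewrite iotaD iotaN. Qed.
Lemma iotaC k : io (ks k) = kst L k. Proof. exact: alg_morphC iota_morph k. Qed.
Lemma iota1 : io 1 = 1. Proof. exact: alg_morph1 iota_morph. Qed.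
Lemma iota0 : io 0 = 0. Proof. exact: alg_morph0 iota_morph. Qed.

Lemma loc_invP (D : denom G m) :
  loc_inv (den_B K n) D * io (den_B K n D) = 1 /\
  io (den_B K n D) * loc_inv (den_B K n) D = 1.
Proof. exact: (loc_relsP (den_B K n)).2. Qed.

Lemma hexpr_BD X Z : he (EAdd X Z) = he X + he Z. Proof. by []. Qed.
Lemma hexpr_BM X Z : he (EMul X Z) = he X * he Z. Proof. by []. Qed.

(** Elements of B_m whose inverse lies in the localized U(h), and not only in the
    localized algebra. *)
Definition hinv u : Prop :=
  exists X, he X * io u = 1 /\ io u * he X = 1.

Lemma hinvM u v : hinv u -> hinv v -> hinv (u * v).
Proof.
move=> [X [hX1 hX2]] [Z [hZ1 hZ2]]; exists (EMul Z X); rewrite hexpr_BM iotaM; split.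
  by rewrite mulrA -[_ * _ * io u]mulrA hX1 mulr1.
by rewrite mulrA -[_ * _ * he Z]mulrA hZ2 mulr1.
Qed.

Lemma hinvZ k : k != 0 -> hinv (ks k).
Proof.
move=> hk; exists (ECst _ _ k^-1); rewrite /= iotaC -!rmorphM mulVf // mulfV //.
Qed.

Lemma hinvN u : hinv u -> hinv (- u).
Proof.
by move=> hu; rewrite -mulN1r -(rmorphN1 ks); apply: hinvM => //; apply: hinvZ;
  rewrite oppr_eq0 oner_eq0.
Qed.

Lemma hinv_den D : hinv (den_B K n D).
Proof. by exists (EInv K D); apply: loc_invP. Qed.

Lemma BF_diag_opp c : BF K G n (opp c) (opp c) = - BF K G n c c.
Proof. by rewrite (F_opp (Bm_U K G m n)) vepsE gsignX2 rmorph1 mul1r. Qed.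

(** With signed indices the denominators F_aa - F_bb + z and F_aa + F_bb + z are
    of one kind, and the family is visibly stable under signed permutations. *)
Lemma hinv_pair c e (z : int) : c.2 != e.2 ->
  hinv (BF K G n c c + BF K G n e e + z%:~R).
Proof.
wlog hlt : c e z / (c.2 < e.2)%N => [hw hne|_].
  have [h|h|h] := ltngtP c.2 e.2; first exact: hw.
    by rewrite [BF _ _ _ c c + _]addrC; apply: hw; rewrite 1?eq_sym.
  by case/eqP: hne; apply: val_inj.
have flip (u v w : B) : u + v + w = - (- u - v - w) by rewrite !opprD !opprK.
case: c e hlt => [[] a] [[] b] /= hlt.
- rewrite -![(true, _)]/(opp (pos _)) !BF_diag_opp flip !opprK -mulrNz.
  exact: (hinvN (hinv_den (exist _ (DAdd a b (- z)) hlt))).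
- rewrite -![(true, _)]/(opp (pos _)) !BF_diag_opp flip !opprK -mulrNz.
  exact: (hinvN (hinv_den (exist _ (DSub a b (- z)) hlt))).
- rewrite -![(true, _)]/(opp (pos _)) !BF_diag_opp.
  exact: (hinv_den (exist _ (DSub a b z) hlt)).
- exact: (hinv_den (exist _ (DAdd a b z) hlt)).
Qed.

Lemma hinv_single c (z : int) : G = GO -> hinv (BF K G n c c + z%:~R).
Proof.
move=> hGO; have hv a z' : den_valid G (DOne a z') by rewrite hGO.
case: c => [[] a].
  rewrite -![(true, _)]/(opp (pos _)) !BF_diag_opp -[_ + _]opprK opprD opprK -mulrNz.
  exact: (hinvN (hinv_den (exist _ (DOne a (- z)) (hv _ _)))).
exact: (hinv_den (exist _ (DOne a z) (hv _ _))).
Qed.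

Lemma den_shapeP (D : denom G m) :
  (exists c e (z : int), c.2 != e.2 /\
     den_B K n D = BF K G n c c + BF K G n e e + z%:~R) \/
  (G = GO /\ exists c (z : int), den_B K n D = BF K G n c c + z%:~R).
Proof.
case: D => [[a b z|a b z|a z] hv]; rewrite /den_B /=.
- left; exists (pos a), (opp (pos b)), z; rewrite BF_diag_opp; split=> //.
  by apply: contraTneq hv => /= ->; rewrite ltnn.
- left; exists (pos a), (pos b), z; split=> //.
  by apply: contraTneq hv => /= ->; rewrite ltnn.
- right; split; first by case: (G) hv.
  by exists (pos a), z.
Qed.

(** F_(a,a) takes the value - mu_(bar a) at mu, hence the signs. *)
Definition den_shift (k : 'I_m -> int) (D : den_shape m) : den_shape m :=
  let f a := k (rev_ord a) in
  match D with
  | DSub a b z => DSub a b (z - f a + f b)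
  | DAdd a b z => DAdd a b (z - f a - f b)
  | DOne a z => DOne a (z - f a)
  end.

Lemma den_shift_valid k D : den_valid G D -> den_valid G (den_shift k D).
Proof. by case: D. Qed.

Definition denom_shift k (D : denom G m) : denom G m :=
  exist _ (den_shift k (val D)) (den_shift_valid k (valP D)).

Fixpoint hshift (k : 'I_m -> int) X : hexpr :=
  match X with
  | ECst x => ECst _ _ x
  | EVar a => EAdd (EVar _ _ a) (ECst _ _ (k a)%:~R)
  | EAdd X Y => EAdd (hshift k X) (hshift k Y)
  | EMul X Y => EMul (hshift k X) (hshift k Y)
  | EInv D => EInv _ (denom_shift k D)
  end.

Lemma hshift_at k X (mu : 'rV[K]_m) :
  hexpr_at (hshift k X) mu = hexpr_at X (mu + \row_b (k b)%:~R).
Proof.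
elim: X => //= [a|X -> Y ->|X -> Y ->|[D hD]] //; first by rewrite !mxE.
congr (_^-1); case: D hD => [a b z|a b z|a z] _ /=;
  rewrite !mxE ?(rmorphB, rmorphD) /= !(opprD, opprK) -!addrA; congr (_ + _).
- by rewrite [RHS]addrCA; congr (_ + _); rewrite [LHS]addrC -!addrA.
- by rewrite [RHS]addrCA; congr (_ + _); rewrite [LHS]addrC -addrA.
- by rewrite addrC.
Qed.

Section Root.
Variable a : 'I_m.
Local Notation F := (F_ K G n a).
Local Notation fshift := (hshift (fun b => - etaz a b)).

Lemma Bh_mulF b : Bh K G n b * F = F * (Bh K G n b - (etaz a b)%:~R).
Proof.
rewrite mulrBr [F * Bh _ _ _ _]mulr_bracket bracket_F_Bh mulrzr addrK //.
Qed.

Lemma BF_mulF b : BF K G n (pos b) (pos b) * F =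
  F * (BF K G n (pos b) (pos b) + (etaz a (rev_ord b))%:~R).
Proof.
have -> : BF K G n (pos b) (pos b) = - Bh K G n (rev_ord b).
  by rewrite /Bh -BF_diag_opp /bar /= rev_ordK.
by rewrite mulNr Bh_mulF -mulrN opprD opprK.
Qed.

Lemma den_mulF D : den_B K n D * F = F * den_B K n (denom_shift (fun b => - etaz a b) D).
Proof.
have zF (z : int) : z%:~R * F = F * z%:~R by rewrite mulrzl mulrzr.
case: D => [[b c z|b c z|b z] hv]; rewrite /den_B /=;
  rewrite ?(mulrDl, mulrBl, mulNr) !BF_mulF zF -?mulrN -!mulrDr; congr (_ * _);
  move: (etaz a (rev_ord b)) => x; try move: (etaz a (rev_ord c)) => y;
  rewrite ?(rmorphB, rmorphD, rmorphN) /= ?(opprD, opprK) -!addrA; congr (_ + _).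
- by rewrite [LHS]addrCA; congr (_ + _); rewrite [RHS]addrC -addrA.
- by rewrite [LHS]addrCA; congr (_ + _); rewrite [RHS]addrC -addrA.
- by rewrite addrC.
Qed.

(** F_a has weight - eta_a; therefore the right ideal generated by F_a is stable
    under left multiplication by the localized U(h). *)
Lemma hexpr_mulF X : he X * io F = io F * he (fshift X).
Proof.
elim: X => [k|b|X IHX Y IHY|X IHX Y IHY|D].
- exact: (@kstC _ L k (io F)).
- rewrite -[LHS]/(io (Bh K G n b) * io F) -[he _]/(io (Bh K G n b) + kst L (- etaz a b)%:~R).
  by rewrite -iotaM Bh_mulF iotaM iotaB -(rmorph_int ks) iotaC rmorphN /= rmorphN.
- by rewrite -[hshift _ _]/(EAdd (fshift X) (fshift Y)) !hexpr_BD mulrDl mulrDr IHX IHY.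
- rewrite -[hshift _ _]/(EMul (fshift X) (fshift Y)) !hexpr_BM.
  by rewrite -mulrA IHY mulrA IHX mulrA.
set k := fun b => _; have [h1 _] := loc_invP D.
have [_ h2] := loc_invP (denom_shift k D).
rewrite -[he _]/(loc_inv (den_B K n) D) -[he _]/(loc_inv (den_B K n) (denom_shift k D)).
rewrite -[LHS]mulr1 -h2 !mulrA; congr (_ * _).
by rewrite -mulrA -iotaM -den_mulF iotaM mulrA h1 mul1r.
Qed.
End Root.

End Fractions.

(** * Telescoping sums *)

(** In the application t s y is the class of c_s E^s y modulo J, where
    c_s = 1 / (s! H^(s)). Then c_s E^s F = c_(s-1) E^(s-1) modulo J, which is all
    that is used about the operator xi = sum_s c_s E^s (ad F)^s. *)
Section Telescoping.
Variables (A : pzRingType) (F : A) (V : zmodType) (t : nat -> A -> V).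
Local Notation ad := (commr F).
Hypothesis tD : forall s, {morph t s : x y / x + y}.
Hypothesis t0F : forall y, t 0%N (F * y) = 0.
Hypothesis tSF : forall s y, t s.+1 (F * y) = t s y.
Implicit Types (x y g : A) (s N : nat).

Lemma telescope0 s : t s 0 = 0.
Proof. by apply: (addrI (t s 0)); rewrite -tD !addr0. Qed.

Lemma telescopeN s : {morph t s : y / - y}.
Proof. by move=> y; apply: (addrI (t s y)); rewrite -tD !subrr telescope0. Qed.

Lemma telescopeMn s y k : t s (y *+ k) = t s y *+ k.
Proof. by elim: k => [|k IH]; rewrite ?telescope0 // !mulrS tD IH. Qed.

Lemma telescopeMz s y (z : int) : t s (y *~ z) = t s y *~ z.
Proof. by case: z => k; rewrite ?NegzE ?mulrNz ?telescopeN -!pmulrn telescopeMn. Qed.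

Lemma iter_ad0 s : iter s ad 0 = 0.
Proof. by elim: s => //= s ->; rewrite bracket0. Qed.

Lemma iter_adD s : {morph iter s ad : x y / x + y}.
Proof. by move=> x y; elim: s => //= s ->; rewrite bracketD. Qed.

Lemma iter_ad_eq0 N s y : iter N ad y = 0 -> (N <= s)%N -> iter s ad y = 0.
Proof. by move=> h /subnK <-; rewrite iterD h iter_ad0. Qed.

Lemma iter_ad_mulr s y g : commr F g = 0 -> iter s ad (y * g) = iter s ad y * g.
Proof. by move=> h; elim: s => //= s ->; rewrite bracketM h mulr0 addr0. Qed.

Lemma iter_adS_mulr s y g : commr F (commr F g) = 0 ->
  iter s.+1 ad (y * g) = iter s.+1 ad y * g + (iter s ad y * commr F g) *+ s.+1.
Proof.
move=> h; elim: s => [|s IH]; first by rewrite /= bracketM mulr1n.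
rewrite iterS IH bracketD bracketMn !bracketM h mulr0 addr0 -!iterS.
by rewrite -addrA -mulrS.
Qed.

Lemma telescope_mulrF s y : t s (y * F) = t s (F * y) - t s (ad y).
Proof. by rewrite -telescopeN -tD /commr opprB addrC subrK. Qed.

(** Since F commutes with itself, the terms are those of y, multiplied by F on the
    right; replacing x F by F x - ad F(x) makes the sum telescope. *)
Lemma sum_ad_mulrF N y : iter N ad y = 0 ->
  \sum_(0 <= s < N) t s (iter s ad (y * F)) = 0.
Proof.
have cF : commr F F = 0 by rewrite /commr subrr.
case: N => [|N] h; first by rewrite big_geq.
have -> : \sum_(0 <= s < N.+1) t s (iter s ad (y * F)) = - t N (iter N.+1 ad y).
  elim: N {h} => [|N IH]; first by rewrite big_nat1 /= telescope_mulrF t0F add0r.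
  by rewrite big_nat_recr // IH (iter_ad_mulr N.+1) // telescope_mulrF tSF /= addKr.
by rewrite h telescope0 oppr0.
Qed.

Variable W : V -> Prop.
Hypotheses (W0 : W 0) (WD : forall u v, W u -> W v -> W (u + v))
  (WN : forall u, W u -> W (- u)).

(** Here W is a subgroup modulo which x f = 0 and x g = - eta x. By Leibniz the
    s-th term is then - eta a_s + s eta (a_(s-1) - a_s), with
    a_s = t s ((ad F)^s y), that is, eta (s a_(s-1) - (s+1) a_s); so the sum
    telescopes as well. *)
Lemma sum_ad_weight N y g f (eta : int) :
  commr F g = (F - f) *~ eta -> commr F f = 0 -> iter N ad y = 0 ->
  (forall s x, W (t s (x * (g + eta%:~R)))) -> (forall s x, W (t s (x * f))) ->
  W (\sum_(0 <= s < N.+1) t s (iter s ad (y * g))).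
Proof.
move=> adg adf adN Wg Wf.
have WM u (z : int) : W u -> W (u *~ z).
  move=> hu; have hk k : W (u *+ k) by elim: k => // k IH; rewrite mulrS; apply: WD.
  by case: z => k; rewrite ?NegzE ?mulrNz -?pmulrn; [|apply: WN].
have adz x (z : int) : commr F (x *~ z) = commr F x *~ z.
  by case: z => k; rewrite ?NegzE ?mulrNz ?bracketN -?pmulrn bracketMn.
have adadg : commr F (commr F g) = 0.
  by rewrite adg adz bracketB adf subr0 /commr subrr mul0rz.
pose a s := t s (iter s ad y).
have aS s : t s.+1 (iter s ad y * F) = a s - a s.+1 by rewrite telescope_mulrF tSF.
have split N' : W (\sum_(0 <= s < N'.+1) t s (iter s ad (y * g)) + (a N' *+ N'.+1) *~ eta).
  elim: N' => [|N' IH].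
    rewrite big_nat1 /= mulr1n.
    have := Wg 0%N y; rewrite mulrDr tD mulrzr telescopeMz //.
  rewrite big_nat_recr // iter_adS_mulr // tD telescopeMn.
  have -> : t N'.+1 (iter N'.+1 ad y * g) =
     t N'.+1 (iter N'.+1 ad y * (g + eta%:~R)) - a N'.+1 *~ eta.
    by rewrite mulrDr tD mulrzr telescopeMz addrK.
  rewrite adg -mulrzr mulrA mulrzr telescopeMz mulrBr tD telescopeN aS.
  set T := \sum_(0 <= s < _) _ in IH *; set p := t _ (_ * (g + _)); set q := t _ (_ * f).
  have -> : T + (p - a N'.+1 *~ eta + (a N' - a N'.+1 - q) *~ eta *+ N'.+1)
     + a N'.+1 *+ N'.+2 *~ eta =
     (T + a N' *+ N'.+1 *~ eta) + p - (q *~ eta) *+ N'.+1.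
    have swap (x : V) : x *~ eta *+ N'.+1 = x *+ N'.+1 *~ eta by rewrite !pmulrn mulrzAC.
    rewrite !mulrzBl !mulrnBl !swap [_ *+ N'.+2]mulrSr mulrzDl !addrA.
    by rewrite [LHS](ACl (1*4*2*6*(3*8)*(5*7))) /= addNr addNr !addr0.
  apply: WD; first by apply: WD => //; apply: Wg.
  by apply: WN; rewrite pmulrn; exact: WM (WM _ _ (Wf _ _)).
have := split N; rewrite /a adN telescope0 mul0rn mul0rz addr0 //.
Qed.

End Telescoping.

(** * Images of the left ideals in the space of coinvariants *)

Section Coinvariants.
Variables (K : numFieldType) (G : gtype) (m n : nat).
Local Notation B := (Bm K G m n).
Local Notation L := (Bbar K G m n).
Local Notation io := (@iota_B K G m n).
Local Notation he := (@hexpr_B K G m n).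
Local Notation pi := (@piJ K G m n).
Local Notation ks := (kst B).
Implicit Types (u v w : L) (x y : B) (mu : 'rV[K]_m) (delta : 'I_m -> int).

Lemma piJD : {morph pi : u v / u + v}.
Proof. exact: Quotient.pi_add. Qed.

Lemma piJ0 : pi 0 = 0.
Proof. by apply: (addrI (pi 0)); rewrite -piJD !addr0. Qed.

Lemma piJN : {morph pi : u / - u}.
Proof. by move=> u; apply: (addrI (pi u)); rewrite -piJD !subrr piJ0. Qed.

Lemma piJ_eq0 u : Jbar u -> pi u = 0.
Proof.
move=> h; rewrite -piJ0; apply/eqP.
have := Quotient.idealrBE (right_ideal_pred (@n_gens K G m n)) u 0.
by rewrite subr0 => <-; apply/asboolP.
Qed.

Lemma Jbar_gen c e w : (rank e < rank c)%N -> Jbar (io (Fo K G n c e) * w).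
Proof.
move=> hr; exists 1%N, (fun=> io (Fo K G n c e) * w); split=> [_|]; last by rewrite big_ord1.
exists (io (Fo K G n c e)), w; split=> //.
by exists (obar c), (obar e); rewrite ival_lt_obar.
Qed.

Lemma JIP mu delta (q : JB K G m n) :
  JI mu delta q <-> exists2 u, Ibar mu delta u & pi u = q.
Proof.
split=> [[u [v [w [hv /piJ_eq0 hw ->]]] <-]|[u hu <-]].
  by exists v; rewrite // piJD hw addr0.
exists u => //; exists u, 0; split=> //; last by rewrite addr0.
by exists 0%N, (fun=> 0); rewrite big_ord0; split=> // -[].
Qed.

Lemma JI0 mu delta : @JI K G m n mu delta 0.
Proof.
by apply/JIP; exists 0; [exists 0%N, (fun=> 0); rewrite big_ord0; split=> // -[] | exact: piJ0].
Qed.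

Lemma JID mu delta (p q : JB K G m n) :
  JI mu delta p -> JI mu delta q -> JI mu delta (p + q).
Proof.
move=> /JIP[u hu <-] /JIP[v hv <-]; apply/JIP; exists (u + v); last exact: piJD.
exact: fin_sumsD.
Qed.

Lemma JI_sum mu delta (I : finType) (f : I -> JB K G m n) :
  (forall i, JI mu delta (f i)) -> JI mu delta (\sum_i f i).
Proof. by move=> h; apply: big_ind => //; [exact: JI0 | exact: JID]. Qed.

Lemma JI_hexpr mu delta X y : Imu mu delta y -> JI mu delta (pi (he X * io y)).
Proof.
move=> hy; apply/JIP; exists (he X * io y) => //.
by exists 1%N, (fun=> he X * io y); split=> [_|]; [exists X, y | rewrite big_ord1].
Qed.

Lemma JIN mu delta (p : JB K G m n) : JI mu delta p -> JI mu delta (- p).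
Proof.
move=> /JIP[u [k [f [hf ->]]] <-]; rewrite -piJN; apply/JIP.
exists (- \sum_i f i) => //; rewrite -sumrN; exists k, (fun i => - f i); split=> // i.
have [X [y [hy ->]]] := hf i; exists X, (- y); split; first exact: left_idealN.
by rewrite iotaN mulrN.
Qed.

Lemma Imu_Qo mu delta c i : dcoord delta c = 1 -> Imu mu delta (Qo K G c i : B).
Proof.
move=> hc; apply: left_ideal_gen; left; exists (Qo K G c i), 0; split; last by rewrite addr0.
  case: c hc => [[] r]; rewrite /dcoord /Qo /Q /obar /= ?expr1 ?expr0 ?mul1r ?mulN1r => hr.
    by apply: left_ideal_gen; exists r, i; left; rewrite -hr opprK.
  by apply: left_idealM; apply: left_ideal_gen; exists r, (tilde i); right.
exact: left_ideal0.
Qed.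

Lemma Imu_Do mu delta c e : (rank c < rank e)%N -> Imu mu delta (Do K G n c e).
Proof.
move=> hr; apply: left_ideal_gen; left; exists 0, (Do K G n c e); split; last by rewrite add0r.
  exact: left_ideal0.
by apply: left_ideal_gen; exists (obar c), (obar e); rewrite ival_lt_obar.
Qed.

Lemma Imu_h mu delta b : Imu mu delta (Do K G n (pos b) (pos b) - ks (mu 0 b)).
Proof. by apply: left_ideal_gen; right; exists b. Qed.

(** The generators of I_(mu,delta) in the labelling by weights. *)
Lemma Imu_ind mu delta (T : B -> Prop) :
  T 0 -> (forall x y, T x -> T y -> T (x + y)) -> (forall x y, T y -> T (x * y)) ->
  (forall c i, dcoord delta c = 1 -> T (Qo K G c i)) ->
  (forall c e, (rank c < rank e)%N -> T (Do K G n c e)) ->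
  (forall b, T (Do K G n (pos b) (pos b) - ks (mu 0 b))) ->
  forall y, Imu mu delta y -> T y.
Proof.
move=> T0 TD TM TP TY Th; apply: (left_ideal_ind (P := T)) => // y s Ts.
apply: (TM); case: Ts => [[u [v [hu hv ->]]]|[b ->]]; last exact: Th.
apply: (TD).
- move: u hu; apply: (left_ideal_ind (P := T)) => // z t [b [i hs]]; apply: (TM).
  case: hs => -[hb ->].
    have := TP (opp (pos b)) i; rewrite /Qo /Q /obar /dcoord /= expr1 mulN1r hb opprK.
    exact.
  rewrite [Bd _ _ _ _](d_Q G (@Bx K G m n)); apply: (TM).
  by apply: (TP (pos b)); rewrite /dcoord expr0 mul1r.
- move: v hv; apply: (left_ideal_ind (P := T)) => // z t [c [e [hce ->]]]; apply: (TM).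
  have := TY (obar c) (obar e); rewrite /Do /Fo /Zo !obarK; apply.
  by rewrite -ival_lt_obar !obarK.
Qed.

End Coinvariants.

(** * The operator of a simple root on the reflected ideal *)

Section Step.
Variables (K : numFieldType) (G : gtype) (m n : nat).
Hypothesis hG : G = GSp -> ~~ odd n.
Variable a : 'I_m.
Hypothesis ha : G = GSp -> ~~ is_last a.
Local Notation B := (Bm K G m n).
Local Notation L := (Bbar K G m n).
Local Notation io := (@iota_B K G m n).
Local Notation he := (@hexpr_B K G m n).
Local Notation ks := (kst B).
Local Notation Fo := (Fo K G n).
Local Notation Zo := (Zo K G n).
Local Notation Do := (Do K G n).
Local Notation Qo := (@Qo K G m n).
Local Notation E := (E_ K G n a).
Local Notation F := (F_ K G n a).
Local Notation H := (H_ K G n a).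
Local Notation ad := (commr F).
Local Notation p := (nxt a).
Local Notation q := (pos a).
Local Notation rootc := (rootc K a).
Implicit Types (b : 'I_m) (c d e : idx m) (i : 'I_n) (y z : B) (N s : nat).

(** All of B_m is locally nilpotent under ad F, so the series for xi_a has
    finitely many terms. *)
Definition adnil y : Prop := exists N, iter N ad y = 0.

Lemma adnil_ad y : adnil (ad y) -> adnil y.
Proof. by move=> [N hN]; exists N.+1; rewrite iterSr. Qed.

Lemma adnil0 : adnil 0. Proof. by exists 0%N. Qed.

Lemma adnilD y z : adnil y -> adnil z -> adnil (y + z).
Proof.
move=> [N hN] [M hM]; exists (maxn N M); rewrite iter_adD.
by rewrite !(iter_ad_eq0 hN, iter_ad_eq0 hM) ?leq_maxl ?leq_maxr // addr0.
Qed.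

Lemma adnilM y z : adnil y -> adnil z -> adnil (y * z).
Proof.
suff hNM k N M y' z' : (N + M <= k)%N -> iter N ad y' = 0 -> iter M ad z' = 0 ->
    adnil (y' * z').
  by move=> [N hN] [M hM]; apply: (hNM _ N M).
elim: k N M y' z' => [|k IH] [|N] [|M] y' z' hk //=; rewrite ?addnS ?addSn in hk;
  try by [move=> -> _; rewrite mul0r; exact: adnil0
         | move=> _ ->; rewrite mulr0; exact: adnil0].
move=> hN hM; apply: adnil_ad; rewrite bracketM; apply: adnilD.
  by apply: (IH N M.+1); rewrite -?iterSr // addnS; lia.
by apply: (IH N.+1 M); rewrite -?iterSr // addSn; lia.
Qed.

Lemma adnil_kst k : adnil (ks k).
Proof. by exists 1%N; exact: bracket_kst. Qed.

Lemma adnilZ k y : adnil y -> adnil (ks k * y).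
Proof. by apply: adnilM; apply: adnil_kst. Qed.

Lemma adnilN y : adnil y -> adnil (- y).
Proof. by move=> hy; rewrite -mulN1r -(rmorphN1 ks); apply: adnilZ. Qed.

Lemma adnilMn y (t : bool) : adnil y -> adnil (y *+ t).
Proof. by case: t => // _; apply: adnil0. Qed.

Lemma pq_neq : (p == q = false) * (q == p = false) * (opp p == p = false) *
  (opp q == q = false) * (p == opp p = false) * (q == opp q = false).
Proof.
by rewrite nxt_neq [q == p]eq_sym nxt_neq ![_ == opp _]eq_sym !opp_neq.
Qed.

Lemma ad_Fo c e : ad (Fo c e) = ks rootc * adj G Fo p q c e.
Proof. by rewrite F_rootE bracketZl bracket_Fo_Fo. Qed.

Lemma ad_Qo c i : ad (Qo c i) = ks rootc *
  (Qo p i *+ (c == q) - ks (veps K G p q) * Qo (opp q) i *+ (c == opp p)).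
Proof. by rewrite F_rootE bracketZl bracket_Fo_Qo. Qed.

Lemma adnil_Qo c i : adnil (Qo c i).
Proof.
have step d : (d == q) = false -> (d == opp p) = false -> adnil (Qo d i).
  move=> h1 h2; exists 1%N; rewrite -[LHS]/(ad _) ad_Qo h1 h2 !mulr0n.
  by rewrite subrr mulr0.
apply: adnil_ad; rewrite ad_Qo; apply: adnilZ; apply: adnilD.
  by apply: adnilMn; apply: step; rewrite pq_neq.
apply: adnilN; apply: adnilMn; apply: adnilZ; apply: step.
  by rewrite pq_neq.
by rewrite (inj_eq (@opp_inj m)) pq_neq.
Qed.

(** Each bracket with F moves the first index from q to p or from opp p to opp q,
    or the second index in the opposite direction; no index can be moved twice. *)
Lemma adnil_Fo c e : adnil (Fo c e).
Proof.
have adj_nil (c' e' : idx m) :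
    ((c' == q) || (c' == opp p) -> adnil (Fo p e') /\ adnil (Fo (opp q) e')) ->
    ((e' == p) || (e' == opp q) -> adnil (Fo c' q) /\ adnil (Fo c' (opp p))) ->
    adnil (Fo c' e').
  move=> h1 h2; apply: adnil_ad; rewrite ad_Fo; apply: adnilZ; rewrite /adj.
  have hb (t : bool) y : (t -> adnil y) -> adnil (y *+ t).
    by case: t => [h|_]; [apply: h | apply: adnil0].
  apply: adnilD; [apply: adnilD; [apply: adnilD|]|].
  - by apply: hb => hc; apply: (h1 _).1; rewrite hc.
  - by apply: adnilN; apply: hb => hc; apply: adnilZ; apply: (h1 _).2; rewrite hc orbT.
  - by apply: adnilN; apply: hb => hc; apply: (h2 _).1; rewrite hc.
  - by apply: hb => hc; apply: adnilZ; apply: (h2 _).2; rewrite hc orbT.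
have upF (c' : idx m) : (c' == p) || (c' == opp q) -> ((c' == q) || (c' == opp p)) = false.
  by case/orP => /eqP ->; rewrite ?(inj_eq (@opp_inj m)) !pq_neq.
have dnF (e' : idx m) : (e' == q) || (e' == opp p) -> ((e' == p) || (e' == opp q)) = false.
  by case/orP => /eqP ->; rewrite ?(inj_eq (@opp_inj m)) !pq_neq.
have both (c' e' : idx m) : ((c' == q) || (c' == opp p)) = false ->
    ((e' == p) || (e' == opp q)) = false -> adnil (Fo c' e').
  by move=> h1 h2; apply: (adj_nil); rewrite ?h1 ?h2.
have up (c' e' : idx m) : ((c' == q) || (c' == opp p)) = false -> adnil (Fo c' e').
  move=> h1; apply: (adj_nil); first by rewrite h1.
  by move=> _; split; apply: both => //; apply: dnF; rewrite eqxx ?orbT.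
apply: (adj_nil) => _.
  by split; apply: up; apply: upF; rewrite eqxx ?orbT.
have dn (c' e' : idx m) : ((e' == p) || (e' == opp q)) = false -> adnil (Fo c' e').
  move=> h2; apply: (adj_nil); last by rewrite h2.
  by move=> _; split; apply: both => //; apply: upF; rewrite eqxx ?orbT.
by split; apply: dn; apply: dnF; rewrite eqxx ?orbT.
Qed.

Lemma adnil_all y : adnil y.
Proof.
move: y; apply: presented_ind => [k|[c e|b i|b i]|y z hy hz|y z hy hz].
- exact: adnil_kst.
- by rewrite -[c]obarK -[e]obarK; apply: adnil_Fo.
- rewrite -[pgen _ _]/(Q G (@Bx K G m n) (@Bd K G m n) (pos b) i) -[pos b]obarK.
  exact: (adnil_Qo (obar (pos b)) i).
- rewrite -[pgen _ _]/(Bd K G b i) [Bd _ _ _ _](d_Q G (@Bx K G m n)).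
  apply: adnilZ; rewrite -[opp (pos b)]obarK.
  exact: (adnil_Qo (obar (opp (pos b))) (tilde i)).
- exact: adnilD.
- exact: adnilM.
Qed.

Definition xi_den s : B := s`!%:R * H_falling K G n a s.

Lemma hinv_H s : hinv (H - s%:R).
Proof.
have -> : H - s%:R = H + (- s%:Z)%:~R by rewrite rmorphN.
rewrite /H_; case hl: (is_last a).
  apply: hinv_single; case: (G) ha => // /(_ erefl).
  by rewrite hl.
rewrite [Bh K G n (next a)]/Bh -BF_diag_opp; apply: hinv_pair => /=.
apply/eqP => /(inv_inj (@rev_ordK m)) /(congr1 val) /=.
by rewrite (nextE (negbT hl)); lia.
Qed.

Lemma hinv_falling s : hinv (H_falling K G n a s).
Proof.
elim: s => [|s IH]; rewrite /H_falling ?big_ord0 ?big_ord_recr /=.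
  by rewrite -(rmorph1 ks); apply: hinvZ; rewrite oner_eq0.
by apply: hinvM => //; apply: hinv_H.
Qed.

Lemma hinv_xi_den s : hinv (xi_den s).
Proof.
apply: hinvM; last exact: hinv_falling.
by rewrite -(rmorph_nat ks); apply: hinvZ; rewrite pnatr_eq0 -lt0n fact_gt0.
Qed.

Definition xi_coef s : L := rinv (io (xi_den s)).

Lemma xi_coef_hexpr s : exists X, xi_coef s = he X.
Proof.
by have [X [h1 h2]] := hinv_xi_den s; exists X; apply: rinvE.
Qed.

Lemma xi_coefP s : xi_coef s * io (xi_den s) = 1 /\ io (xi_den s) * xi_coef s = 1.
Proof.
have [X [h1 h2]] := hinv_xi_den s.
by rewrite (_ : xi_coef s = he X) //; apply: rinvE.
Qed.

Lemma xi_coef0 : xi_coef 0 = 1.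
Proof.
have [+ _] := xi_coefP 0.
by rewrite /xi_den fact0 mul1r /H_falling big_ord0 iota1 mulr1.
Qed.

(** The factor s (H - s + 1) of exp_sl2 cancels against the new factor of
    s! H^(s). *)
Lemma xi_coefS s : xi_coef s.+1 * io (s.+1%:R * (H - s%:R)) = xi_coef s.
Proof.
have [h1 h2] := xi_coefP s; have [h3 h4] := xi_coefP s.+1.
have cH (i j : nat) : GRing.comm (H - i%:R) (H - j%:R).
  apply: GRing.commrB; [apply: GRing.commr_sym|exact: GRing.commr_nat].
  by apply: GRing.commrB; [exact: GRing.commr_refl | exact: GRing.commr_nat].
have comm k : GRing.comm (H - s%:R) (H_falling K G n a k).
  by rewrite /H_falling; apply: GRing.commr_prod => i _; apply: cH.
have hd : xi_den s.+1 = s.+1%:R * (H - s%:R) * xi_den s.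
  rewrite /xi_den [H_falling _ _ _ _ s.+1]big_ord_recr /= -/(H_falling _ _ _ _ s) -comm.
  rewrite factS natrM -!mulrA; congr (_ * _).
  by rewrite !mulrA; congr (_ * _); rewrite mulr_natl mulr_natr.
by rewrite -[LHS]mulr1 -h2 -mulrA [_ * (io (xi_den s) * _)]mulrA -iotaM -hd mulrA h3 mul1r.
Qed.

(** Writing the leading term y as the term s = 0. *)
Lemma xi_sum N y : iter N ad y = 0 ->
  xi a y = \sum_(0 <= s < N) xi_coef s * io (E ^+ s) * io (iter s ad y).
Proof.
move=> hN.
have h0 s : (N <= s)%N -> xi_coef s * io (E ^+ s) * io (iter s ad y) = 0.
  by move=> hs; rewrite (iter_ad_eq0 hN hs) iota0 mulr0.
have -> : \sum_(0 <= s < N) xi_coef s * io (E ^+ s) * io (iter s ad y) =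
          \sum_(0 <= s < N.+1) xi_coef s * io (E ^+ s) * io (iter s ad y).
  by rewrite big_nat_recr //= h0 // addr0.
rewrite big_ltn // xi_coef0 expr0 iota1 mul1r /= mul1r /xi; congr (_ + _).
rewrite (fsbigE (iota 1 N)) ?iota_uniq //.
- rewrite /index_iota subn1 /= [LHS]big_seq_cond [RHS]big_seq_cond; apply: eq_bigl => s.
  have -> : (s \in [set s | (1 <= s)%N]%classic) = (1 <= s)%N.
    by apply/idP/idP; rewrite inE.
  by rewrite andbT mem_iota; lia.
- by move=> s /=; rewrite mem_iota => /andP[].
- move=> s /= hs; rewrite mem_iota => hs2; apply: h0; lia.
Qed.

(** The hypothesis delta_pq excludes delta_a = 1, delta_(a+1) = -1, respectively
    delta_m = 1. In these cases the x and d selected by delta are not stable under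
    the bracket with F, which maps Qo q to Qo p. *)
Section Target.
Variables (nu : 'rV[K]_m) (delta : 'I_m -> int) (X0 : hexpr K G m).
Hypotheses (delta2 : forall b, delta b = 1 \/ delta b = -1)
  (delta_pq : dcoord delta q = 1 -> dcoord delta p = 1).
Local Notation W := (JI (nu - eta K a) delta).

Definition xi_term s y : JB K G m n := piJ (he X0 * xi_coef s * io (E ^+ s) * io y).

Lemma xi_termD s : {morph xi_term s : y z / y + z}.
Proof. by move=> y z; rewrite /xi_term iotaD mulrDr piJD. Qed.

Lemma piJ_hexpr_mulF X y : piJ (he X * io (F * y)) = 0 :> JB K G m n.
Proof.
apply: piJ_eq0; rewrite iotaM mulrA hexpr_mulF F_rootE iotaM iotaC kstC -!mulrA.
by apply: Jbar_gen; rewrite rank_nxt rank_pos.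
Qed.

Lemma xi_term0_mulF y : xi_term 0%N (F * y) = 0.
Proof. by rewrite /xi_term xi_coef0 expr0 iota1 !mulr1; apply: piJ_hexpr_mulF. Qed.

Lemma xi_termS_mulF s y : xi_term s.+1 (F * y) = xi_term s y.
Proof.
rewrite /xi_term -!mulrA -iotaM mulrA [E ^+ _ * _]mulrA.
rewrite (exp_sl2 _ (bracket_E_F K n ha) (bracket_E_H K G n a)).
rewrite mulrDl iotaD mulrDr piJD.
have [X hX] := xi_coef_hexpr s.+1.
rewrite -[F * _ * y]mulrA {1}hX -hexpr_BM piJ_hexpr_mulF add0r -mulrA !iotaM.
by rewrite -iotaM -mulrA [xi_coef _ * _]mulrA xi_coefS !mulrA.
Qed.

Lemma xi_term_Imu s y : Imu (nu - eta K a) delta y -> W (xi_term s y).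
Proof.
move=> hy; have [X hX] := xi_coef_hexpr s.
rewrite /xi_term -mulrA -iotaM hX -hexpr_BM; apply: JI_hexpr; exact: left_idealM.
Qed.

Lemma piJ_xi_sum N y : iter N ad y = 0 ->
  piJ (he X0 * xi a y) = \sum_(0 <= s < N) xi_term s (iter s ad y).
Proof.
move=> /xi_sum ->; rewrite mulr_sumr (big_morph _ (@piJD K G m n) (@piJ0 K G m n)).
by apply: eq_bigr => s _; rewrite /xi_term !mulrA.
Qed.

(** The pairs c < e for which Fo c e lies in the nilradical of the minimal
    parabolic subalgebra: n' without the two multiples Fo q p and
    Fo (opp p) (opp q) of E. *)
Definition nilradical_pair c e : bool :=
  [&& (rank c < rank e)%N, ~~ ((c == q) && (e == p)) &
      ~~ ((c == opp p) && (e == opp q))].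

Definition stable_gens : set B := [set y |
  (exists c i, dcoord delta c = 1 /\ y = Qo c i) \/
  (exists c e, nilradical_pair c e /\ y = Do c e)]%classic.

Lemma dcoord_opp_pos : dcoord delta p <> 1 -> dcoord delta (opp q) = 1.
Proof.
rewrite dcoord_opp; have := delta_pq.
have -> : dcoord delta q = delta a by rewrite /dcoord expr0 mul1r.
by case: (delta2 a) => -> // /(_ erefl) ->.
Qed.

(** The form in which inequalities between indices become linear arithmetic. *)
Lemma nilradical_pairE c e : nilradical_pair c e =
  [&& (rank c < rank e)%N, ~~ ((rank c == a) && (rank e == a.+1)) &
      ~~ ((rank c == m.*2 - a.+2)%N && (rank e == m.*2 - a.+1)%N)].
Proof.
by rewrite /nilradical_pair -!(inj_eq (@rank_inj m)) !rank_opp !rank_nxt !rank_pos.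
Qed.

Lemma stable_gens_ad y : left_ideal stable_gens y -> left_ideal stable_gens (ad y).
Proof.
move: y; apply: left_ideal_ind => [|y z hy hz|y g hg].
- by rewrite bracket0; apply: left_ideal0.
- by rewrite bracketD; apply: left_idealD.
rewrite bracketM; apply: left_idealD; first exact/left_idealM/left_ideal_gen.
apply: left_idealM.
have hb (b : bool) y' : (b -> left_ideal stable_gens y') -> left_ideal stable_gens (y' *+ b).
  by case: b => [h|_]; [apply: h | apply: left_ideal0].
have hP d i : dcoord delta d = 1 -> left_ideal stable_gens (Qo d i).
  by move=> hd; apply: left_ideal_gen; left; exists d, i.
have hY d e : nilradical_pair d e -> left_ideal stable_gens (Do d e).
  by move=> hd; apply: left_ideal_gen; right; exists d, e.
have hm := ltn_ord a.
case: hg => [[c [i [hc ->]]]|[c [e [+ ->]]]].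
  rewrite ad_Qo; apply: left_idealM; apply: left_idealB; apply: hb => /eqP hcq.
    by apply: hP; apply: delta_pq; rewrite -hcq.
  apply: left_idealM; apply: hP; apply: dcoord_opp_pos => h.
  by move: hc; rewrite hcq dcoord_opp h.
rewrite nilradical_pairE => /and3P[h1 h2 h3].
rewrite F_rootE bracketZl bracket_Fo_Do // /adj; apply: left_idealM.
have hr := (rank_nxt, rank_pos, rank_opp); have := rank_lt c; have := rank_lt e => he1 hc1.
apply: left_idealD; [apply: left_idealB; [apply: left_idealB|]|];
  apply: hb => /eqP hce; try apply: left_idealM; apply: hY; rewrite nilradical_pairE;
  move: h1 h2 h3 he1 hc1; rewrite hce !hr; lia.
Qed.

Lemma stable_gens_Imu y : left_ideal stable_gens y -> Imu (nu - eta K a) delta y.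
Proof.
apply: left_ideal_sub => z [[c [i [hc ->]]]|[c [e [/and3P[h _ _] ->]]]].
  exact: (Imu_Qo G (nu - eta K a) i hc).
exact: (Imu_Do G n (nu - eta K a) delta h).
Qed.

(** Up to a factor zeta(F) is the sum of theta_k Qo p k * Qo (opp q) (tilde k);
    the two factors commute, and delta selects Qo p or Qo (opp q). *)
Lemma root_zeta_ideal (T : set B) :
  (forall c i, dcoord delta c = 1 -> left_ideal T (Qo c i)) ->
  left_ideal T (ks rootc * Zo p q).
Proof.
move=> hT; apply: left_idealM; rewrite /Zo /Bzeta (zetaE hG (@Bm_PD K G m n)).
rewrite (inj_eq (@obar_inj m)) pq_neq mul0r rmorph0 add0r -obar_opp; apply: left_idealM.
have hS c e : dcoord delta e = 1 ->
    left_ideal T (bilin G (@Bx K G m n) (@Bd K G m n) (obar c) (obar e)).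
  by move=> he1; apply: left_ideal_sum => k; apply: left_idealM; exact: hT.
have [h1|h1] := eqVneq (dcoord delta p) 1; last first.
  by apply: hS; apply: dcoord_opp_pos; apply/eqP.
rewrite (bilin_sym hG (@Bm_PD K G m n)) -obar_opp !(inj_eq (@obar_inj m)) (inj_eq (@opp_inj m)).
rewrite pq_neq mulr0n mulr0 rmorph0 subr0; apply: left_idealN; apply: left_idealM.
exact: hS.
Qed.

(** Generators of the image of I_(mu,delta) under the braid automorphism, where nu
    and delta are the reflected data. F stands for F - zeta(F), which is possible
    by root_zeta_ideal. *)
Definition reflected_gens : set B := [set y | stable_gens y \/ y = F \/
  exists b, y = Do (pos b) (pos b) - ks (nu 0 b)]%classic.

Lemma JI_sum_xi_stable N y : (forall s, left_ideal stable_gens (iter s ad y)) ->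
  W (\sum_(0 <= s < N) xi_term s (iter s ad y)).
Proof.
move=> hy; apply: big_ind => [|u v|s _]; [exact: JI0 | exact: JID | ].
by apply: xi_term_Imu; apply: stable_gens_Imu.
Qed.

(** For the stable generators every term of the series lies in the target ideal;
    for F and for the Cartan generators the series telescopes. In the last case
    the weight drops from nu to nu - eta_a: the bracket of F with such a
    generator is a multiple, by a label of eta_a, of F - zeta(F). *)
Lemma xi_reflected y : left_ideal reflected_gens y -> W (piJ (he X0 * xi a y)).
Proof.
move: y; apply: left_ideal_ind => [|y z hy hz|y g hg].
- rewrite (piJ_xi_sum (N := 0)) // big_geq //; exact: JI0.
- have [N hN] := adnil_all y; have [M hM] := adnil_all z.
  pose k := maxn N M.
  have hk1 : iter k ad y = 0 by apply: iter_ad_eq0 hN _; apply: leq_maxl.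
  have hk2 : iter k ad z = 0 by apply: iter_ad_eq0 hM _; apply: leq_maxr.
  have hk3 : iter k ad (y + z) = 0 by rewrite iter_adD hk1 hk2 addr0.
  move: hy hz; rewrite (piJ_xi_sum hk1) (piJ_xi_sum hk2) (piJ_xi_sum hk3) => hy hz.
  rewrite (eq_bigr (fun s => xi_term s (iter s ad y) + xi_term s (iter s ad z))).
    by rewrite big_split; apply: JID.
  by move=> s _; rewrite iter_adD xi_termD.
have [N hN] := adnil_all y.
case: hg => [hg|[->|[b ->]]].
- have hpar s : left_ideal stable_gens (iter s ad (y * g)).
    elim: s => [|s IH]; first exact/left_idealM/left_ideal_gen.
    exact: stable_gens_ad.
  have [M hM] := adnil_all (y * g).
  by rewrite (piJ_xi_sum hM); apply: JI_sum_xi_stable.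
- have hF : iter N ad (y * F) = 0.
    by rewrite iter_ad_mulr ?hN ?mul0r // /commr subrr.
  rewrite (piJ_xi_sum hF) (sum_ad_mulrF xi_termD xi_term0_mulF xi_termS_mulF hN); exact: JI0.
clear g; set g := Do _ _ - _.
have adg : ad g = (F - ks rootc * Zo p q) *~ etaz a b.
  rewrite bracketB bracket_kst subr0 F_rootE bracketZl bracket_Fo_Do // adj_diag => [|c e].
    by rewrite root_weight_F mulrzAr mulrBr.
  exact: Do_opp.
have adf : ad (ks rootc * Zo p q) = 0.
  rewrite F_rootE bracketZl bracketZ bracket_Fo_Zo // /adj !pq_neq.
  by rewrite !mulr0n !subrr addr0 !mulr0.
have hyg : iter N.+1 ad (y * g) = 0.
  have hadad : commr F (commr F g) = 0.
    rewrite adg -mulrzr bracketM bracketB adf /commr subrr subr0 mul0r add0r.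
    by rewrite mulrzl mulrzr subrr mulr0.
  by rewrite iter_adS_mulr // hN mul0r mul0rn addr0 (iter_ad_eq0 hN) ?mul0r.
rewrite (piJ_xi_sum hyg).
apply: (sum_ad_weight (W := JI (nu - eta K a) delta) xi_termD xi_termS_mulF (JI0 _ _ _ _)
  _ _ adg adf hN) => [u v|u|s x|s x].
- exact: JID.
- exact: JIN.
- apply: xi_term_Imu; apply: left_idealM.
  have := Imu_h G n (nu - eta K a) delta b.
  by rewrite !mxE eta_etaz rmorphB rmorph_int /g opprB addrA addrAC.
- apply: xi_term_Imu; apply: left_idealM; apply: root_zeta_ideal => c i hc.
  exact: (Imu_Qo G _ i hc).
Qed.

End Target.

End Step.

(** * The braid group action *)

Section Braid.
Variables (K : numFieldType) (G : gtype) (m n : nat).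
Hypothesis hG : G = GSp -> ~~ odd n.
Variable a : 'I_m.
Local Notation B := (Bm K G m n).
Local Notation L := (Bbar K G m n).
Local Notation io := (@iota_B K G m n).
Local Notation he := (@hexpr_B K G m n).
Local Notation ks := (kst B).
Local Notation kl := (kst L).
Local Notation BF := (BF K G n).
Local Notation QB := (Q G (@Bx K G m n) (@Bd K G m n)).
Local Notation gsign := (gsign K G).
Variable s : L -> L.
Hypothesis hs : is_braid_aut a s.
Implicit Types (b : 'I_m) (c d e : idx m) (i : 'I_n) (y z : B).

Let sM : alg_morph s. Proof. by case: hs. Qed.

(** For a = m the braid automorphism exchanges Q at the indices 1 and -1, with
    this sign. *)
Definition braid_sign c : K :=
  gsign ^+ (is_last a && (~~ c.1 && (c.2 == 0%N :> nat))).

Lemma braid_sign2 c : braid_sign c * braid_sign c = 1.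
Proof. exact: gsignX2. Qed.

Lemma sigma_bar_obar c : sigma_bar a (obar c) = obar (sigma a c).
Proof. by rewrite /sigma_bar /obar bar_opp barK sigma_opp. Qed.

Lemma braid_BF c e :
  s (io (BF c e)) = kl (braid_sign c * braid_sign e) * io (BF (sigma_bar a c) (sigma_bar a e)).
Proof.
case: hs => _; rewrite /braid_sign; case: ifP => _ [-> _ _]; last first.
  by rewrite /= mulr1 rmorph1 mul1r.
by rewrite exprD.
Qed.

Lemma sigma_bar_opp c : sigma_bar a (opp c) = opp (sigma_bar a c).
Proof. by rewrite /sigma_bar bar_opp sigma_opp. Qed.

Lemma sigma_bar_last c : is_last a ->
  sigma_bar a c = if c.2 == 0%N :> nat then opp c else c.
Proof.
move=> hl; have hr : rev_ord a = 0%N :> nat.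
  by move: hl; rewrite /is_last /=; have := ltn_ord a; lia.
have eqr (r : 'I_m) : (rev_ord r == a) = (r == 0%N :> nat).
  by rewrite -(inj_eq (inv_inj (@rev_ordK m))) rev_ordK -(inj_eq val_inj) -hr.
rewrite /sigma_bar sigma_signed_swap /signed_swap /nxt hl oppK.
case: c => [[] r]; rewrite /bar /pos /opp /= !xpair_eqE /= eqr; case: eqP => h //=;
  by rewrite ?rev_ordK //; congr (_, _); apply: val_inj; move: hr h => /=; lia.
Qed.

Lemma sigma_bar_pos b : ~~ is_last a -> sigma_bar a (pos b) = pos (sigma_bar a (pos b)).2.
Proof.
move=> hl; rewrite {1}[sigma_bar a (pos b)]surjective_pairing; congr (_, _).
rewrite /sigma_bar sigma_signed_swap /signed_swap /nxt (negPf hl).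
by do 4?case: ifP.
Qed.

Lemma braid_Q c i : s (io (QB c i)) = kl (braid_sign c) * io (QB (sigma_bar a c) i).
Proof.
case: hs => _; rewrite /braid_sign; case: ifPn => hl [_ hx hd]; last first.
  rewrite expr0 rmorph1 mul1r; case: c => [[] b]; last first.
    by rewrite -[(false, b)]/(pos b) (sigma_bar_pos _ hl); apply: hx.
  rewrite -[(true, b)]/(opp (pos b)) sigma_bar_opp (sigma_bar_pos _ hl).
  set d := (sigma_bar a (pos b)).2.
  rewrite -[QB _ _]/(ks (theta K G (tilde i)) * Bd K G b (tilde i)).
  rewrite -[QB (opp (pos d)) _]/(ks (theta K G (tilde i)) * Bd K G d (tilde i)).
  by rewrite !iotaM (alg_morphM sM) !iotaC (alg_morphC sM) hd.
rewrite (sigma_bar_last _ hl); case: eqP => h0; last first.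
  rewrite andbF expr0 rmorph1 mul1r /Q; case: c.1.
    by rewrite iotaM (alg_morphM sM) iotaC (alg_morphC sM) (hd _ _ h0).2.
  by rewrite (hd _ _ h0).1.
case: c h0 => [[] b] /= h0.
  rewrite -[QB _ _]/(ks (theta K G (tilde i)) * Bd K G b (tilde i)).
  rewrite -[QB (opp (true, b)) _]/(Bx K G b i).
  rewrite iotaM (alg_morphM sM) iotaC (alg_morphC sM) (hx _ _ h0).2 tildeK.
  by rewrite mulrA -rmorphM theta2 rmorph1 !mul1r.
rewrite -[QB (false, b) _]/(Bx K G b i) (hx _ _ h0).1.
rewrite -[QB _ _]/(ks (theta K G (tilde i)) * Bd K G b (tilde i)).
rewrite iotaM iotaC mulrA -rmorphM expr1 (theta_tilde K hG) mulrA mulrN gsign2.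
by rewrite mulN1r rmorphN.
Qed.

Lemma sigma_bar_inj : injective (sigma_bar a).
Proof.
by move=> x y /(inv_inj (@barK m)) /perm_inj /(inv_inj (@barK m)).
Qed.

Lemma braid_sign_opp e : gsign ^+ e.1 * braid_sign (opp e) =
  braid_sign e * gsign ^+ (sigma_bar a e).1.
Proof.
rewrite /braid_sign; case: (boolP (is_last a)) => hl.
  rewrite (sigma_bar_last _ hl) /= negbK; case: eqP => _.
    by rewrite !andbT !gsignX2.
  by rewrite !andbF expr0 mulr1 mul1r.
rewrite expr0 mulr1 mul1r; case: e => [[] b]; last first.
  by rewrite -[(false, b)]/(pos b) (sigma_bar_pos _ hl).
by rewrite -[(true, b)]/(opp (pos b)) sigma_bar_opp (sigma_bar_pos _ hl).
Qed.

Lemma braid_zeta c e : s (io (Bzeta K G n c e)) =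
  kl (braid_sign c * braid_sign e) * io (Bzeta K G n (sigma_bar a c) (sigma_bar a e)).
Proof.
have sS (u v : idx m) : s (io (bilin G (@Bx K G m n) (@Bd K G m n) u v)) =
    kl (braid_sign u * braid_sign v) *
    io (bilin G (@Bx K G m n) (@Bd K G m n) (sigma_bar a u) (sigma_bar a v)).
  rewrite /bilin !(alg_morph_sum (iota_morph K G m n)) (alg_morph_sum sM) mulr_sumr.
  apply: eq_bigr => k _; rewrite !iotaM !(alg_morphM sM) !braid_Q iotaC (alg_morphC sM).
  rewrite mulrA -!kstC -!mulrA [kl (braid_sign v) * _]mulrA.
  rewrite !mulrA -!rmorphM; congr (kl _ * _ * _).
  by rewrite mulrC mulrA.
rewrite /Bzeta !(zetaE hG (@Bm_PD K G m n)) -sigma_bar_opp !iotaD !iotaM !iotaC.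
rewrite (alg_morphD sM) (alg_morphM sM) !(alg_morphC sM) sS.
rewrite mulrDr !mulrA -!rmorphM (inj_eq sigma_bar_inj); congr (kl _ + kl _ * _).
  case: eqVneq => [->|_]; last by rewrite mul0r mulr0.
  by rewrite braid_sign2 !mul1r.
by rewrite mulrCA [LHS]mulrA -mulrA braid_sign_opp mulrA.
Qed.

Lemma braid_Do c e : exists k : K,
  s (io (Do K G n c e)) = kl k * io (Do K G n (sigma a c) (sigma a e)).
Proof.
exists (braid_sign (obar c) * braid_sign (obar e)).
rewrite /Do /Fo /Zo !iotaB (alg_morphD sM) (alg_morphN sM) braid_BF braid_zeta.
by rewrite -!sigma_bar_obar mulrBr.
Qed.

(** The braid automorphism is given on the localization only; that it comes from
    B_m is seen on generators. *)
Lemma braid_lift y : exists z, io z = s (io y).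
Proof.
move: y; apply: presented_ind => [k|[c e|b i|b i]|y z [y' hy] [z' hz]|y z [y' hy] [z' hz]].
- by exists (ks k); rewrite !iotaC (alg_morphC sM).
- by rewrite -[pgen _ _]/(BF c e) braid_BF -iotaC -iotaM; eexists.
- rewrite -[pgen _ _]/(QB (pos b) i) braid_Q -iotaC -iotaM; by eexists.
- rewrite -[pgen _ _]/(Bd K G b i) [Bd _ _ _ _](d_Q G (@Bx K G m n)).
  by rewrite iotaM (alg_morphM sM) braid_Q iotaC (alg_morphC sM) -!iotaC -!iotaM; eexists.
- by exists (y' + z'); rewrite !iotaD (alg_morphD sM) hy hz.
- by exists (y' * z'); rewrite !iotaM (alg_morphM sM) hy hz.
Qed.

Lemma braid_BF_diag c : s (io (BF c c)) = io (BF (sigma_bar a c) (sigma_bar a c)).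
Proof. by rewrite braid_BF braid_sign2 rmorph1 mul1r. Qed.

Lemma braid_int (z : int) : s (io z%:~R) = io z%:~R.
Proof. by rewrite -(rmorph_int ks) iotaC (alg_morphC sM). Qed.

Lemma sigma_bar_ord_neq c e : c.2 != e.2 -> (sigma_bar a c).2 != (sigma_bar a e).2.
Proof.
move=> h; apply: contra_neq h => h.
have [h'|h'] : sigma_bar a c = sigma_bar a e \/ sigma_bar a c = sigma_bar a (opp e).
  rewrite sigma_bar_opp; case: (sigma_bar a c) (sigma_bar a e) h => [[] x] [[] y] /= ->;
  by [left | right].
- by rewrite (sigma_bar_inj h').
- by rewrite (sigma_bar_inj h').
Qed.

Lemma braid_hexpr X : exists X', he X' = s (he X).
Proof.
elim: X => [k|b|X [X' hX] Z [Z' hZ]|X [X' hX] Z [Z' hZ]|D].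
- by exists (ECst _ _ k); rewrite -[he (ECst _ _ k)]/(kl k) (alg_morphC sM).
- rewrite -[he (EVar _ _ b)]/(io (BF (obar (pos b)) (obar (pos b)))) braid_BF_diag.
  rewrite sigma_bar_obar; case hsb: (sigma a (pos b)) => [[] c].
    exists (EMul (ECst _ _ (-1)) (EVar _ _ c)).
    rewrite -[(true, c)]/(opp (pos c)) obar_opp BF_diag_opp iotaN.
    by rewrite -[LHS]/(kl (-1) * io (Bh K G n c)) rmorphN1 mulN1r.
  by exists (EVar _ _ c).
- by exists (EAdd X' Z'); rewrite !hexpr_BD (alg_morphD sM) hX hZ.
- by exists (EMul X' Z'); rewrite !hexpr_BM (alg_morphM sM) hX hZ.
have [h1 h2] := @loc_invP K G m n D.
have inv (u : L) : u * s (io (den_B K n D)) = 1 -> u = s (loc_inv (den_B K n) D).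
  move=> hu; apply: (inverse_unique hu).
  by rewrite -(alg_morphM sM) h2 (alg_morph1 sM).
rewrite -[he _]/(loc_inv (den_B K n) D).
suff [X [hX _]] : exists X, he X * s (io (den_B K n D)) = 1 /\ True.
  by exists X; apply: inv.
have [[c [e [z [hce ->]]]]|[hGO [c [z ->]]]] := den_shapeP K n D.
  rewrite !iotaD !(alg_morphD sM) !braid_BF_diag braid_int -!iotaD.
  have [X [hX _]] := hinv_pair K G n z (sigma_bar_ord_neq hce).
  by exists X.
rewrite !iotaD !(alg_morphD sM) !braid_BF_diag braid_int -!iotaD.
have [X [hX _]] := hinv_single K n (sigma_bar a c) z hGO.
by exists X.
Qed.

Definition lifts_to (T : set B) y : Prop := exists2 z, left_ideal T z & io z = s (io y).

(** Up to sign the generators of n' are permuted, except for E, which becomes a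
    multiple of F. *)
Lemma braid_Imu (T : set B) mu delta :
  (forall c i, dcoord (dact (sigma a) delta) c = 1 -> left_ideal T (Qo K G c i)) ->
  (forall c e, nilradical_pair a c e -> left_ideal T (Do K G n c e)) ->
  left_ideal T (Do K G n (nxt a) (pos a)) ->
  (forall b, left_ideal T (Do K G n (pos b) (pos b) - ks (wact (sigma a) mu 0 b))) ->
  forall y, Imu mu delta y -> lifts_to T y.
Proof.
move=> TP TY Tr Th; apply: Imu_ind.
- by exists 0; rewrite ?iota0 ?(alg_morph0 sM) //; apply: left_ideal0.
- move=> x y [x' hx hx'] [y' hy hy']; exists (x' + y'); first exact: left_idealD.
  by rewrite !iotaD (alg_morphD sM) hx' hy'.
- move=> x y [y' hy hy']; have [x' hx'] := braid_lift x.
  exists (x' * y'); first exact: left_idealM.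
  by rewrite !iotaM (alg_morphM sM) hx' hy'.
- move=> c i hc; exists (ks (braid_sign (obar c)) * Qo K G (sigma a c) i).
    apply: left_idealM; apply: TP; rewrite dcoord_dact; last exact: sigma_opp.
    by rewrite permK.
  by rewrite braid_Q sigma_bar_obar iotaM iotaC.
- move=> c e hce; have [k hk] := braid_Do c e.
  exists (ks k * Do K G n (sigma a c) (sigma a e)); last by rewrite iotaM iotaC hk.
  apply: left_idealM; case: (sigma_rank_lt a hce) => [hlt|[-> ->]|[-> ->]].
  + apply: TY; rewrite /nilradical_pair hlt /=.
    apply/andP; split; apply/negP => /andP[/eqP h1 /eqP h2].
      move: hce; rewrite -[c](sigmaK a) -[e](sigmaK a) h1 h2 sigma_nxt sigma_pos.
      by rewrite rank_nxt rank_pos; lia.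
    move: hce; rewrite -[c](sigmaK a) -[e](sigmaK a) h1 h2 !sigma_opp sigma_nxt sigma_pos.
    by rewrite !rank_opp rank_nxt rank_pos; lia.
  + by rewrite sigma_nxt sigma_pos.
  + rewrite !sigma_opp sigma_nxt sigma_pos Do_opp //.
    by apply: left_idealN; apply: left_idealM.
move=> b; have hb : s (io (Do K G n (pos b) (pos b))) =
    io (Do K G n (sigma a (pos b)) (sigma a (pos b))).
  rewrite /Do /Fo /Zo !iotaB (alg_morphD sM) (alg_morphN sM) braid_BF braid_zeta.
  by rewrite -!sigma_bar_obar braid_sign2 rmorph1 !mul1r.
exists (Do K G n (sigma a (pos b)) (sigma a (pos b)) - ks (mu 0 b)); last first.
  by rewrite iotaB [in RHS]iotaB (alg_morphD sM) (alg_morphN sM) hb iotaC (alg_morphC sM).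
have hw b' : wact (sigma a) mu 0 b' = coord mu (sigma a (pos b')).
  by rewrite wactE ?sigmaV //; apply: sigma_opp.
case hsb: (sigma a (pos b)) => [[] b'].
  have := Th b'; rewrite hw.
  have -> : sigma a (pos b') = opp (pos b).
    by apply: (@perm_inj _ (sigma a)); rewrite sigmaK sigma_opp hsb.
  rewrite coord_opp coord_pos rmorphN opprK -[(true, b')]/(opp (pos b')) Do_opp //.
  rewrite vepsE gsignX2 rmorph1 mul1r -opprD; exact: left_idealN.
have := Th b'; rewrite hw -[(false, b')]/(pos b').
have -> : sigma a (pos b') = pos b.
  by apply: (@perm_inj _ (sigma a)); rewrite sigmaK hsb.
by rewrite coord_pos.
Qed.

End Braid.

(** * Composition along a minimal word *)

(** For so_(2m) and a = m the factor is the braid automorphism alone. *)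
Lemma is_factorP (K : numFieldType) (G : gtype) (m n : nat) (a : 'I_m)
    (T : JB K G m n -> JB K G m n) :
  is_factor a T -> exists2 s, is_braid_aut a s &
  (G = GSp /\ is_last a /\ forall u, T (piJ u) = piJ (s u)) \/
  ((G = GSp -> ~~ is_last a) /\
   exists2 f, is_xi_bar a f & forall u, T (piJ u) = f (s u)).
Proof.
move=> [s hs h]; exists s => //; move: h.
destruct G; first by right.
by case hl: (is_last a) => h; [left | right].
Qed.

Section Factor.
Variables (K : numFieldType) (G : gtype) (m n : nat).
Hypothesis hG : G = GSp -> ~~ odd n.
Variables (a : 'I_m) (T : JB K G m n -> JB K G m n).
Hypothesis hT : is_factor a T.
Variables (mu : 'rV[K]_m) (delta : 'I_m -> int).
Hypothesis delta2 : forall b, delta b = 1 \/ delta b = -1.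
Hypothesis hpos : (G = GSp -> ~~ is_last a) ->
  dcoord delta (nxt a) = 1 -> dcoord delta (pos a) = 1.
Local Notation io := (@iota_B K G m n).
Local Notation he := (@hexpr_B K G m n).
Local Notation nu := (shifted_act G (sigma a) mu).
Local Notation delta' := (dact (sigma a) delta).

Lemma dact_sign b : delta' b = 1 \/ delta' b = -1.
Proof.
rewrite dactE /dcoord; move: (_ (pos b)) => [t c] /=.
by case: (delta2 c) => ->; case: t; rewrite ?expr0 ?expr1 ?mulr1 ?mulrN1 ?opprK; auto.
Qed.

(** If the factor is the braid automorphism alone, it preserves n', because
    F_(-1,1) and F_(1,-1) vanish in so_(2m), and rho is fixed by sigma_m. *)
Lemma factor_step q : JI mu delta q -> JI nu delta' (T q).
Proof.
move=> /JIP[u [k [g [hg ->]]] <-].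
have [s hs [[hGSp [hl ->]]|[ha [f [fD fxi] ->]]]] := is_factorP hT; have [sM _] := hs.
- rewrite (alg_morph_sum sM) (big_morph _ (@piJD K G m n) (@piJ0 K G m n)).
  apply: JI_sum => i; have [X [y [hy ->]]] := hg i.
  have enu : nu = wact (sigma a) mu.
    by rewrite shifted_act_sigma hGSp hl subr0.
  have [z hz hzs] : exists2 z, Imu nu delta' z & io z = s (io y).
    apply: (braid_Imu hG hs _ _ _ _ hy).
    - by move=> c j; apply: Imu_Qo.
    - by move=> c e /and3P[h _ _]; apply: Imu_Do.
    - rewrite /nxt hl; suff -> : Do K G n (opp (pos a)) (pos a) = 0 by apply: left_ideal0.
      have := Do_opp K hG (opp (pos a)) (pos a); rewrite oppK => h0.
      set y0 := Do _ _ _ _ _ in h0 *.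
      have h2 : kst (Bm K G m n) 2 * y0 = 0.
        rewrite rmorph_nat mulr_natl mulr2n {1}h0 vepsE (_ : gsign K G = 1).
          by rewrite !expr1n mulr1 rmorph1 mul1r addNr.
        by rewrite /gsign hGSp.
      rewrite -[y0]mul1r -(rmorph1 (kst _)) -(mulVf (_ : 2 != 0 :> K)) ?pnatr_eq0 //.
      by rewrite rmorphM -mulrA h2 mulr0.
    - by move=> b; rewrite -enu; apply: Imu_h.
  have [X' hX'] := braid_hexpr hs X.
  by rewrite (alg_morphM sM) -hX' -hzs; apply: JI_hexpr.
have f0 : f 0 = 0 by apply: (addrI (f 0)); rewrite -fD !addr0.
rewrite (alg_morph_sum sM) (big_morph f fD f0); apply: JI_sum => i.
have [X [y [hy ->]]] := hg i.
have enu : nu = wact (sigma a) mu - eta K a.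
  rewrite shifted_act_sigma; case: ifP => //.
  by move: ha; case: (G) => // /(_ erefl) /negPf ->.
have hpq : dcoord delta' (pos a) = 1 -> dcoord delta' (nxt a) = 1.
  rewrite !dcoord_dact; try exact: sigma_opp.
  by rewrite sigmaV sigma_pos sigma_nxt; apply: hpos.
have [X' hX'] := braid_hexpr hs X.
have [z hz hzs] : lifts_to s (reflected_gens (n := n) a (wact (sigma a) mu) delta') y.
  apply: (braid_Imu hG hs _ _ _ _ hy).
  - move=> c j hc; apply: left_ideal_gen; left; left; by exists c, j.
  - move=> c e hce; apply: left_ideal_gen; left; right; by exists c, e.
  - have r0 : rootc K a != 0.
      by rewrite /rootc; case: ifP; rewrite ?invr_eq0 ?oner_eq0 ?pnatr_eq0.
    rewrite -[Do _ _ _ _ _]mul1r -(rmorph1 (kst _)) -(mulVf r0) rmorphM -mulrA.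
    apply: left_idealM; rewrite /Do mulrBr -F_rootE; apply: left_idealB.
      by apply: left_ideal_gen; right; left.
    apply: (root_zeta_ideal hG dact_sign hpq) => c j hc.
    by apply: left_ideal_gen; left; left; exists c, j.
  - by move=> b; apply: left_ideal_gen; right; right; exists b.
rewrite (alg_morphM sM) -hX' -hzs (fxi X' (hshift (etaz a) X')) => [|rho _].
  by rewrite enu; apply: (xi_reflected hG ha _ dact_sign hpq hz).
rewrite hshift_at; congr (hexpr_at X' (rho + _)).
by apply/rowP => b; rewrite eta_etaz !mxE.
Qed.

End Factor.

(** The letters of a minimal word are applied from the right. For the suffix v the
    sequence is v(delta_+), whose entry at c is the sign of the inverse image of c
    under v; by minimal_word_positive the pair of signs at (a, nxt a) is never
    the excluded one. *)
Lemma word_step (K : numFieldType) (G : gtype) (m n : nat)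
    (hG : G = GSp -> ~~ odd n) (mu : 'rV[K]_m) (s : {perm idx m})
    (ops : 'I_m -> JB K G m n -> JB K G m n) (u v : seq 'I_m) (q : JB K G m n) :
  min_word G (u ++ v) s -> (forall a, a \in v -> is_factor a (ops a)) ->
  JI mu (@delta_plus m) q ->
  JI (shifted_act G (word_perm v) mu) (dact (word_perm v) (@delta_plus m))
     (foldr (fun a => ops a) q v).
Proof.
move=> hmin hops hq; elim: v u hmin hops => [|a v IH] u hmin hops /=.
  have -> : shifted_act G (word_perm [::]) mu = mu.
    rewrite /shifted_act -[RHS](addrK (rho K G m)); congr (_ - _).
    by apply: row_coordP => c; rewrite coord_wact ?invg1 ?perm1 // => d; rewrite !perm1.
  have -> : dact (word_perm [::]) (@delta_plus m) = @delta_plus m.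
    by apply/funext => b; rewrite dactE invg1 perm1 /dcoord expr0 mul1r.
  exact: hq.
have sgn_word c : dcoord (dact (word_perm v) (@delta_plus m)) c =
    (-1) ^+ ((word_perm v)^-1%g c).1.
  by rewrite dcoord_dact ?/dcoord ?mulr1 //; apply: word_perm_opp.
rewrite shifted_act_cons dact_cons; apply: factor_step => //.
- by apply: hops; rewrite mem_head.
- move=> b; have := sgn_word (pos b); rewrite {1}/dcoord expr0 mul1r => ->.
  by case: (_.1); auto.
- move=> ha; rewrite !sgn_word; have := minimal_word_positive hmin ha.
  case: ((word_perm v)^-1%g (nxt a)) ((word_perm v)^-1%g (pos a)) =>
    [[] [c hc]] [[] [d hd]] //=; rewrite /rank /=; lia.
apply: (IH (rcons u a)); first by rewrite cat_rcons.
by move=> b hb; apply: hops; rewrite inE hb orbT.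
Qed.

Theorem theorem5p3 (R : realType) (G : gtype) (m n : nat)
    (hm : (1 <= m)%N) (hn : (1 <= n)%N) (hG : G = GSp -> ~~ odd n)
    (mu : 'rV[R[i]]_m)
    (hmu : forall (a b : 'I_m) (z : int), (a < b)%N ->
       mu 0 a - mu 0 b <> z%:~R /\ mu 0 a + mu 0 b <> z%:~R)
    (hmu_sp : G = GO -> forall (a : 'I_m) (z : int), 2 * mu 0 a <> z%:~R)
    (s : {perm (idx m)}) (hs : signed_perm s)
    (xi_s : JB R[i] G m n -> JB R[i] G m n)
    (hxi : is_xi_check s xi_s) :
  forall q : JB R[i] G m n,
    JI mu (@delta_plus m) q ->
    JI (shifted_act G s mu) (dact s (@delta_plus m)) (xi_s q).
Proof.
move=> q hq; have [w [ops [hw hops ->]]] := hxi.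
have -> : s = word_perm w.
  by apply/permP => c; rewrite word_permE; apply: hw.1.
exact: (word_step (u := [::]) hG hw hops hq).
Qed.
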